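(* For $r\in\mathbb{R}$ and $x\in(0,4)$ we have \[ V_{2,r}(x)=\frac{\cos\left(r\cdot\arccos\sqrt{x/4}\right)}{\pi\sqrt{x^{1-r}(4-x)}}. \] In particular, for $x\in(0,4)$, \[ V_{2,0}(x)=\frac{1}{\pi\sqrt{x(4-x)}},\qquad V_{2,-1/2}(x)=\frac{1}{2\pi}\sqrt{\frac{\sqrt{x}+2}{\sqrt{x^3}(4-x)}}, \] \[ V_{2,1/2}(x)=\frac{1}{2\pi}\sqrt{\frac{\sqrt{x}+2}{\sqrt{x}(4-x)}},\qquad V_{2,1}(x)=\frac{\sqrt{x}}{2\pi\sqrt{4-x}}. \]
   Context: For $p>1$ and $r\in\mathbb{R}$, \[ \psi_{p,r}(\sigma)=\frac{\Gamma\big((\sigma-1)p+r+1\big)}{\Gamma(\sigma)\,\Gamma\big((\sigma-1)(p-1)+r+1\big)}, \] where $1/\Gamma$ is taken to be $0$ at the poles of $\Gamma$ and at removable singularities the value is the limit. $V_{p,r}$ is the inverse Mellin transform of $\psi_{p,r}$: \[ V_{p,r}(x)=\frac{1}{2\pi\mathrm{i}}\int_{d-\mathrm{i}\infty}^{d+\mathrm{i}\infty}x^{-\sigma}\psi_{p,r}(\sigma)\,d\sigma,\qquad x\in(0,c(p)),\quad c(p)=p^p(p-1)^{1-p} \] (so $c(2)=4$), where $d$ is any real number with $d>1-\frac{1+r}{p}$ and the integral is understood as $\lim_{T\to\infty}\int_{d-\mathrm{i}T}^{d+\mathrm{i}T}$ (it exists for rational $p>1$). *)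

(* Defs.v *)
From Stdlib Require Import Reals Factorial ClassicalEpsilon.
From Coquelicot Require Import Coquelicot.

Open Scope R_scope.

Definition Cexp (z : C) : C :=
  (exp (Re z) * cos (Im z), exp (Re z) * sin (Im z)).

(* [x^s] for real [x > 0] and complex [s]. *)
Definition Rcpow (x : R) (s : C) : C := Cexp (s * RtoC (ln x))%C.

(* [z (z + 1) ... (z + n)], with [n + 1] factors. *)
Fixpoint Crising (z : C) (n : nat) : C :=
  match n with
  | O => z
  | S m => (Crising z m * (z + RtoC (INR n)))%C
  end.

(* The limit of a complex-valued function along a filter; it is meaningful only
   where the limit exists. *)
Definition Clim {T : Type} (f : T -> C) (F : (T -> Prop) -> Prop) : C :=
  iota (T := C_CompleteNormedModule) (fun l : C => filterlim f F (locally l)).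

(* The entire function [1 / Gamma], by the Euler-Gauss product
   [1 / Gamma(z) = lim_n z (z + 1) ... (z + n) / (n! n^z)].
   It vanishes exactly at the poles of [Gamma]. *)
Definition rGamma (z : C) : C :=
  Clim (fun n : nat =>
          Crising z n / (RtoC (INR (fact n)) * Rcpow (INR n) z))%C eventually.

(* Meaningful away from the poles [0, -1, -2, ...]. *)
Definition Gamma (z : C) : C := (/ rGamma z)%C.

Definition Gamma_pole (z : C) : Prop := exists n : nat, z = RtoC (- INR n).

Definition psi_num_arg (p r : R) (s : C) : C :=
  ((s - 1) * RtoC p + RtoC r + 1)%C.

Definition psi_raw (p r : R) (s : C) : C :=
  (Gamma (psi_num_arg p r s) * rGamma s
   * rGamma ((s - 1) * (RtoC p - 1) + RtoC r + 1))%C.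

(* A singularity of the quotient can only occur at a pole of the numerator;
   there the value is the limit (which exists when the singularity is
   removable). *)
Definition psi (p r : R) (s : C) : C :=
  if excluded_middle_informative (Gamma_pole (psi_num_arg p r s))
  then Clim (psi_raw p r) (locally' s)
  else psi_raw p r s.

(* [J] is the integral of [f] along the segment from [d - i T] to [d + i T],
   parametrized by [t |-> d + i t]. *)
Definition is_vertical_int (f : C -> C) (d T : R) (J : C) : Prop :=
  is_RInt (fun t : R => f (RtoC d + Ci * RtoC t) * Ci)%C (- T) T J.

(* The inverse Mellin integral of [f] at [x] along [Re s = d] converges to [v]
   as a symmetric limit. *)
Definition is_inverse_Mellin (f : C -> C) (d x : R) (v : C) : Prop :=
  exists J : R -> C,
    (forall T : R, is_vertical_int (fun s => Rcpow x (- s) * f s)%C d T (J T)) /\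
    filterlim (fun T : R => / (2 * RtoC PI * Ci) * J T)%C
      (Rbar_locally p_infty) (locally v).

(* For every admissible abscissa [d] the integral defining [V_{p,r}(x)]
   converges to [v]. *)
Definition is_V (p r x : R) (v : C) : Prop :=
  forall d : R, 1 - (1 + r) / p < d -> is_inverse_Mellin (psi p r) d x v.

Definition V (p r x : R) : C :=
  iota (T := C_CompleteNormedModule) (is_V p r x).

(* Main.v *)
Require Import Defs.
From Stdlib Require Import Reals Lra Lia Factorial ClassicalEpsilon.
From Coquelicot Require Import Coquelicot.
Set Bullet Behavior "Strict Subproofs".
Open Scope R_scope.

(** On the line [Re s = d] the density is [psi 2 r s = (2 / PI) * K s] with
    [K s = int_0^(PI/2) cos (r t) (2 cos t)^(2 s + r - 2) dt] (Cauchy's formula).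
    To prove this from the Euler-Gauss products, integrate by parts to get the two-step
    recurrence of [K], which turns [K s] into a quotient of rising factorials times [K (s + n)];
    the weights [(2 cos t)^(2 n)] concentrate at [t = 0], so [K (s + n)] is asymptotic to a
    Wallis integral, and what remains are Gauss approximants of the three [1 / Gamma].

    Exchanging the integrals, the truncated inverse Mellin integral becomes
    [int h(t) sin (T u(t)) / u(t) dt] with the phase [u t = 2 ln (2 cos t) - ln x], which
    vanishes only at [t = acos (sqrt (x / 4))].  Riemann-Lebesgue and Dirichlet's integral give
    the limit [PI * h / |u'|] at that point.  The integrand is singular at [t = PI / 2] when
    [2 d + r < 2], so everything is cut off at [b < PI / 2], with errors uniform in [T]. *)

(** * Limits in the complex plane *)

(** The integral [K s] comes from computing forwards. Under [x = 4 (cos t)^2] the asserted density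
    [V2 r x dx] becomes [(2 / PI) cos (r t) (2 cos t)^r dt] and [x^(s-1)] becomes
    [(2 cos t)^(2 s - 2)], so [(2 / PI) K s] is the Mellin transform of [V2 r]. What has to be shown
    is that this transform is [psi 2 r], and that it can be inverted along every admissible line.
    The first point works because [m^2 - r^2 = (m - r) (m + r)]: for [m = 2 s + r + 2 n] the
    coefficients of the recurrence split into linear factors belonging to exactly the three Gamma
    functions of [psi]. In the second point the obstacle is that [psi 2 r s] decays only like
    [|s|^(-1/2)] along a vertical line. The inverse integral does not converge absolutely, so the
    symmetric truncation is kept to the end and the limit comes from oscillation alone. Moreover the
    derivative [-2 tan t] of the phase vanishes at [t = 0], so the integration by parts behind
    Riemann-Lebesgue fails there as well as at the zero of the phase; near both points a bound
    uniform in [T] takes its place. *)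

(** Neighbourhoods in [C] are given by boxes of the product structure; passing to discs lets every
    later estimate be made with [Cmod]. *)
Lemma filterlim_Cmod {T : Type} (F : (T -> Prop) -> Prop) {FF : Filter F}
  (f : T -> C) (l : C) :
  filterlim f F (locally l) <->
  forall eps, 0 < eps -> F (fun t => Cmod (f t - l) < eps).
Proof.
  split.
  - intros H eps He.
    apply (H (fun z => Cmod (z - l) < eps)).
    exact (locally_le_locally_norm (V := C_NormedModule) l _
             (ex_intro _ (mkposreal eps He) (fun y Hy => Hy))).
  - intros H P HP.
    destruct (locally_norm_le_locally (V := C_NormedModule) l _ HP) as [e He].
    unfold filtermap.
    apply (filter_imp (fun t => Cmod (f t - l) < e)).
    + intros t Ht. now apply He.
    + apply H, cond_pos.
Qed.

Lemma filterlim_C_unique {T : Type} (F : (T -> Prop) -> Prop) {FF : ProperFilter F}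
  (f : T -> C) (l l' : C) :
  filterlim f F (locally l) -> filterlim f F (locally l') -> l = l'.
Proof.
  exact (filterlim_locally_unique (V := C_NormedModule) f l l').
Qed.

Lemma Clim_unique {T : Type} (F : (T -> Prop) -> Prop) {FF : ProperFilter F}
  (f : T -> C) (l : C) :
  filterlim f F (locally l) -> Clim f F = l.
Proof.
  intros H. apply (iota_unique (V := C_CompleteNormedModule)); [|exact H].
  intros y Hy. exact (filterlim_C_unique F f y l Hy H).
Qed.

Lemma filterlim_C_cauchy {T : Type} (F : (T -> Prop) -> Prop) {FF : ProperFilter F}
  (f : T -> C) :
  (forall eps, 0 < eps ->
    exists P, F P /\ forall u v, P u -> P v -> Cmod (f v - f u) < eps) ->
  exists l, filterlim f F (locally l).
Proof.
  intros H.
  apply (proj1 (filterlim_locally_cauchy (U := C_CompleteNormedModule) (F := F) f)).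
  intros eps. destruct (H eps (cond_pos eps)) as [P [HP HPu]].
  exists P. split; [exact HP|]. intros u v Hu Hv.
  apply C_NormedModule_mixin_compat1. now apply HPu.
Qed.

Lemma filterlim_Re {T : Type} (F : (T -> Prop) -> Prop) {FF : Filter F}
  (f : T -> C) (l : C) :
  filterlim f F (locally l) -> filterlim (fun t => Re (f t)) F (locally (Re l)).
Proof.
  intros H. eapply filterlim_comp; [exact H|].
  intros P HP. destruct HP as [e He]. exists e. intros y [Hy _]. now apply He.
Qed.

Lemma filterlim_Im {T : Type} (F : (T -> Prop) -> Prop) {FF : Filter F}
  (f : T -> C) (l : C) :
  filterlim f F (locally l) -> filterlim (fun t => Im (f t)) F (locally (Im l)).
Proof.
  intros H. eapply filterlim_comp; [exact H|].
  intros P HP. destruct HP as [e He]. exists e. intros y [_ Hy]. now apply He.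
Qed.

Lemma filterlim_C_pair {T : Type} (F : (T -> Prop) -> Prop) {FF : Filter F}
  (f : T -> C) (l : C) :
  filterlim (fun t => Re (f t)) F (locally (Re l)) ->
  filterlim (fun t => Im (f t)) F (locally (Im l)) ->
  filterlim f F (locally l).
Proof.
  intros H1 H2.
  apply filterlim_locally. intros eps.
  generalize (filter_and _ _
    (proj1 (filterlim_locally _ _) H1 eps) (proj1 (filterlim_locally _ _) H2 eps)).
  apply filter_imp. intros t [Ha Hb]. split; assumption.
Qed.

Lemma filterlim_Rplus {T : Type} (F : (T -> Prop) -> Prop) {FF : Filter F}
  (f g : T -> R) (l m : R) :
  filterlim f F (locally l) -> filterlim g F (locally m) ->
  filterlim (fun t => f t + g t) F (locally (l + m)).
Proof.
  intros Hf Hg. eapply filterlim_comp_2; [exact Hf | exact Hg |].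
  apply (filterlim_plus (V := R_NormedModule)).
Qed.

Lemma filterlim_Rmult {T : Type} (F : (T -> Prop) -> Prop) {FF : Filter F}
  (f g : T -> R) (l m : R) :
  filterlim f F (locally l) -> filterlim g F (locally m) ->
  filterlim (fun t => f t * g t) F (locally (l * m)).
Proof.
  intros Hf Hg. eapply filterlim_comp_2; [exact Hf | exact Hg |].
  apply (filterlim_mult (K := R_AbsRing)).
Qed.

Lemma filterlim_Ropp {T : Type} (F : (T -> Prop) -> Prop) {FF : Filter F}
  (f : T -> R) (l : R) :
  filterlim f F (locally l) -> filterlim (fun t => - f t) F (locally (- l)).
Proof.
  intros Hf. eapply filterlim_comp; [exact Hf|].
  apply (filterlim_opp (V := R_NormedModule)).
Qed.

Lemma filterlim_Cmult {T : Type} (F : (T -> Prop) -> Prop) {FF : Filter F}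
  (f g : T -> C) (l m : C) :
  filterlim f F (locally l) -> filterlim g F (locally m) ->
  filterlim (fun t => f t * g t)%C F (locally (l * m)%C).
Proof.
  intros Hf Hg.
  pose proof (filterlim_Re _ _ _ Hf). pose proof (filterlim_Im _ _ _ Hf).
  pose proof (filterlim_Re _ _ _ Hg). pose proof (filterlim_Im _ _ _ Hg).
  apply (filterlim_C_pair F); simpl;
    repeat first [assumption | apply filterlim_Rplus | apply filterlim_Ropp | apply filterlim_Rmult].
Qed.

Lemma filterlim_Cplus {T : Type} (F : (T -> Prop) -> Prop) {FF : Filter F}
  (f g : T -> C) (l m : C) :
  filterlim f F (locally l) -> filterlim g F (locally m) ->
  filterlim (fun t => f t + g t)%C F (locally (l + m)%C).
Proof.
  intros Hf Hg.
  apply (filterlim_C_pair F); simpl;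
    first [exact FF | apply filterlim_Rplus];
    first [exact FF | now apply filterlim_Re | now apply filterlim_Im].
Qed.

Lemma filterlim_RtoC {T : Type} (F : (T -> Prop) -> Prop) {FF : Filter F}
  (f : T -> R) (l : R) :
  filterlim f F (locally l) -> filterlim (fun t => RtoC (f t)) F (locally (RtoC l)).
Proof.
  intros H. apply (filterlim_C_pair F); simpl; [exact H|]. apply filterlim_const.
Qed.

Lemma Cmod_le_limit {T : Type} (F : (T -> Prop) -> Prop) {FF : ProperFilter F}
  (f : T -> C) (g : T -> R) (l : C) (m : R) :
  filterlim f F (locally l) -> filterlim g F (locally m) ->
  F (fun t => Cmod (f t) <= g t) -> Cmod l <= m.
Proof.
  intros Hf Hg H.
  apply (filterlim_le (F := F) (fun t => Cmod (f t)) g (Cmod l) m H).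
  - change (filterlim (fun t => Cmod (f t)) F (locally (Cmod l))).
    eapply filterlim_comp; [exact Hf|].
    exact (filterlim_norm (V := C_NormedModule) l).
  - exact Hg.
Qed.

(** * The complex exponential *)

Lemma Cexp_plus (a b : C) : Cexp (a + b) = (Cexp a * Cexp b)%C.
Proof.
  destruct a as [a1 a2], b as [b1 b2]. unfold Cexp, Cmult; simpl.
  rewrite exp_plus, cos_plus, sin_plus. apply injective_projections; simpl; ring.
Qed.

Lemma Cexp_0 : Cexp 0 = 1.
Proof. unfold Cexp; simpl. rewrite exp_0, cos_0, sin_0. apply injective_projections; simpl; ring. Qed.

Lemma Cmod_Cexp (z : C) : Cmod (Cexp z) = exp (Re z).
Proof.
  unfold Cmod, Cexp; simpl.
  replace (_ + _) with (Rsqr (exp (Re z))).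
  - apply sqrt_Rsqr. left; apply exp_pos.
  - unfold Rsqr. pose proof (sin2_cos2 (Im z)) as H. unfold Rsqr in H.
    transitivity (exp (Re z) * exp (Re z) * (sin (Im z) * sin (Im z) + cos (Im z) * cos (Im z))).
    + rewrite H; ring.
    + ring.
Qed.

Lemma Cexp_neq_0 (z : C) : Cexp z <> 0.
Proof.
  intros H. pose proof (Cmod_Cexp z) as E. rewrite H, Cmod_0 in E.
  pose proof (exp_pos (Re z)). lra.
Qed.

Lemma Cexp_RtoC (x : R) : Cexp x = exp x.
Proof. unfold Cexp; simpl. rewrite cos_0, sin_0. apply injective_projections; simpl; ring. Qed.

Lemma Rcpow_plus (x : R) (a b : C) : Rcpow x (a + b) = (Rcpow x a * Rcpow x b)%C.
Proof. unfold Rcpow. rewrite <- Cexp_plus. f_equal. ring. Qed.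

Lemma Rcpow_1 (x : R) : 0 < x -> Rcpow x 1 = x.
Proof.
  intros H. unfold Rcpow. rewrite Cmult_1_l, Cexp_RtoC, exp_ln; auto.
Qed.

Lemma Rcpow_mult (x y : R) (a : C) : 0 < x -> 0 < y ->
  Rcpow (x * y) a = (Rcpow x a * Rcpow y a)%C.
Proof.
  intros Hx Hy. unfold Rcpow. rewrite <- Cexp_plus, ln_mult, RtoC_plus by auto.
  f_equal. ring.
Qed.

Lemma Rcpow_div (x y : R) (a : C) : 0 < x -> 0 < y ->
  Rcpow (x / y) a = (Rcpow x a / Rcpow y a)%C.
Proof.
  intros Hx Hy.
  assert (Hy0 : Rcpow y a <> 0) by apply Cexp_neq_0.
  replace (Rcpow x a) with (Rcpow (x / y * y) a) by (f_equal; field; lra).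
  rewrite Rcpow_mult; [field; exact Hy0 | apply Rdiv_lt_0_compat; lra | exact Hy].
Qed.

Lemma Cmod_Rcpow (x : R) (a : C) : Cmod (Rcpow x a) = Rpower x (Re a).
Proof. unfold Rcpow, Rpower. rewrite Cmod_Cexp. f_equal. simpl. unfold Re. ring. Qed.

Lemma filterlim_Cexp {T : Type} (F : (T -> Prop) -> Prop) {FF : Filter F}
  (f : T -> C) (l : C) :
  filterlim f F (locally l) -> filterlim (fun t => Cexp (f t)) F (locally (Cexp l)).
Proof.
  intros H.
  pose proof (filterlim_Re _ _ _ H). pose proof (filterlim_Im _ _ _ H).
  apply (filterlim_C_pair F); simpl; apply (filterlim_Rmult F).
  1, 3: apply (filterlim_comp _ _ _ (fun t => Re (f t)) exp F (locally (Re l))); auto;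
    apply continuity_pt_filterlim, derivable_continuous_pt, derivable_pt_exp.
  - apply (filterlim_comp _ _ _ (fun t => Im (f t)) cos F (locally (Im l))); auto.
    apply continuity_pt_filterlim, continuity_cos.
  - apply (filterlim_comp _ _ _ (fun t => Im (f t)) sin F (locally (Im l))); auto.
    apply continuity_pt_filterlim, continuity_sin.
Qed.

Lemma filterlim_Rcpow {T : Type} (F : (T -> Prop) -> Prop) {FF : Filter F}
  (f : T -> R) (l : R) (a : C) : 0 < l ->
  filterlim f F (locally l) -> filterlim (fun t => Rcpow (f t) a) F (locally (Rcpow l a)).
Proof.
  intros Hl H. unfold Rcpow. apply (@filterlim_Cexp T F FF). apply (@filterlim_Cmult T F FF).
  - exact (filterlim_const a).
  - refine (filterlim_RtoC F (fun t => ln (f t)) (ln l) _).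
    apply (filterlim_comp _ _ _ f ln F (locally l)); auto.
    apply continuity_pt_filterlim, derivable_continuous_pt.
    exists (/ l). now apply derivable_pt_lim_ln.
Qed.

(** * Convergence of the Euler-Gauss product *)

Lemma sin_ge_cubic (y : R) : 0 <= y <= 4 -> y - y ^ 3 / 6 <= sin y.
Proof.
  intros Hy. destruct (pre_sin_bound y 0 (proj1 Hy) (proj2 Hy)) as [H _].
  unfold sin_approx, sin_term in H. simpl in H. simpl. nra.
Qed.

Lemma Rabs_sin_sub_le (y : R) : Rabs y <= 1 -> Rabs (sin y - y) <= y ^ 2.
Proof.
  assert (P : forall t, 0 <= t <= 1 -> Rabs (sin t - t) <= t ^ 2).
  { intros t Ht. pose proof (sin_ge_cubic t ltac:(lra)).
    assert (sin t <= t).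
    { destruct (Req_dec t 0) as [->|]; [rewrite sin_0; lra|]. left; apply sin_lt_x; lra. }
    rewrite Rabs_left1 by lra. nra. }
  intros Hy. destruct (Rle_dec 0 y).
  - rewrite Rabs_right in Hy by lra. apply P; lra.
  - rewrite Rabs_left in Hy by lra.
    replace (sin y - y) with (- (sin (- y) - - y)) by (rewrite sin_neg; ring).
    rewrite Rabs_Ropp. replace (y ^ 2) with ((- y) ^ 2) by ring. apply P; lra.
Qed.

Lemma Rabs_sin_le (y : R) : Rabs (sin y) <= Rabs y.
Proof.
  assert (P : forall t, 0 <= t -> Rabs (sin t) <= t).
  { intros t Ht. destruct (Rle_dec t 1).
    - pose proof (sin_ge_cubic t ltac:(lra)).
      assert (sin t <= t).
      { destruct (Req_dec t 0) as [->|]; [rewrite sin_0; lra|]. left; apply sin_lt_x; lra. }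
      apply Rabs_le. nra.
    - apply Rabs_le. pose proof (SIN_bound t). lra. }
  destruct (Rle_dec 0 y).
  - rewrite (Rabs_right y) by lra. apply P; lra.
  - rewrite (Rabs_left y) by lra. rewrite <- (Rabs_Ropp (sin y)), <- sin_neg. apply P; lra.
Qed.

Lemma one_sub_cos_le (y : R) : 0 <= 1 - cos y <= y ^ 2 / 2.
Proof.
  pose proof (COS_bound y). split; [lra|].
  replace y with (2 * (y / 2)) at 1 by lra.
  rewrite cos_2a_sin.
  pose proof (Rabs_sin_le (y / 2)) as H0.
  apply Rsqr_le_abs_1 in H0. unfold Rsqr in H0. nra.
Qed.

(** The upper bound inverts [1 - x <= exp (- x)], since [1 / (1 - x) <= 1 + x + 2 x^2] for
    [|x| <= 1/2]. *)
Lemma exp_sub_le (x : R) : Rabs x <= 1 / 2 -> 0 <= exp x - 1 - x <= 2 * x ^ 2.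
Proof.
  intros Hx. apply Rabs_le_between in Hx.
  pose proof (exp_ineq1_le x). split; [lra|].
  pose proof (exp_ineq1_le (- x)) as H0.
  pose proof (exp_pos x) as H1.
  assert (H2 : exp x * exp (- x) = 1) by (rewrite <- exp_plus, Rplus_opp_r, exp_0; auto).
  assert (exp x * (1 - x) <= 1) by nra.
  assert (1 <= (1 - x) * (1 + x + 2 * x ^ 2)) by (simpl; nra).
  apply Rnot_lt_le; intros Hc.
  assert ((1 + x + 2 * x ^ 2) * (1 - x) < exp x * (1 - x)) by (apply Rmult_lt_compat_r; lra).
  lra.
Qed.

Lemma Cmod_le_Rabs_plus (z : C) : Cmod z <= Rabs (Re z) + Rabs (Im z).
Proof.
  replace z with (RtoC (Re z) + Ci * RtoC (Im z))%C at 1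
    by (destruct z; apply injective_projections; simpl; ring).
  eapply Rle_trans; [apply Cmod_triangle|].
  rewrite Cmod_mult, !Cmod_R.
  replace (Cmod Ci) with 1; [lra|].
  unfold Cmod, Ci; simpl. replace (_ + _) with 1 by ring. now rewrite sqrt_1.
Qed.

Lemma Rabs_Im_le (z : C) : Rabs (Im z) <= Cmod z.
Proof. eapply Rle_trans; [apply Rmax_r | apply (Rmax_Cmod z)]. Qed.

Lemma Cmod_sqr (z : C) : Cmod z ^ 2 = Re z ^ 2 + Im z ^ 2.
Proof. unfold Cmod. rewrite pow2_sqrt; [reflexivity|]. nra. Qed.

Lemma Cmod_Cexp_sub_le (z : C) : Cmod z <= 1 / 2 -> Cmod (Cexp z - 1 - z) <= 4 * Cmod z ^ 2.
Proof.
  intros Hz. eapply Rle_trans; [apply Cmod_le_Rabs_plus|].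
  rewrite Cmod_sqr.
  pose proof (re_le_Cmod z) as Hx. pose proof (Rabs_Im_le z) as Hy.
  destruct z as [x y]. simpl Re in *. simpl Im in *.
  pose proof (exp_sub_le x ltac:(lra)) as [E1 E2].
  pose proof (one_sub_cos_le y) as [C1 C2].
  pose proof (Rabs_sin_sub_le y ltac:(lra)) as S1.
  pose proof (Rabs_sin_le y) as S2.
  assert (Hax : Rabs x <= 1 / 2) by lra.
  assert (X2 : Rabs x * Rabs x = x ^ 2) by (rewrite <- Rabs_mult, Rabs_right; nra).
  assert (Y2 : Rabs y * Rabs y = y ^ 2) by (rewrite <- Rabs_mult, Rabs_right; nra).
  pose proof (Rabs_pos x). pose proof (Rabs_pos y).
  assert (D1 : Rabs (exp x - 1) <= 2 * Rabs x).
  { replace (exp x - 1) with ((exp x - 1 - x) + x) by ring.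
    eapply Rle_trans; [apply Rabs_triang|]. rewrite (Rabs_right (_ - _)) by lra. nra. }
  (* Real and imaginary parts are regrouped so that every summand is visibly of second order in [x]
     and [y]. *)
  replace (exp x * cos y + - (1) + - x) with
    ((exp x - 1 - x) + - (exp x * (1 - cos y))) by ring.
  replace (exp x * sin y + - 0 + - y) with ((exp x - 1) * sin y + (sin y - y)) by ring.
  assert (Rabs (exp x - 1 - x + - (exp x * (1 - cos y))) <= 2 * x ^ 2 + y ^ 2).
  { eapply Rle_trans; [apply Rabs_triang|].
    rewrite Rabs_Ropp, (Rabs_right (exp x - 1 - x)), Rabs_mult by lra.
    rewrite (Rabs_right (exp x)), (Rabs_right (1 - cos y)) by
      (pose proof (exp_pos x); lra).
    apply Rabs_le_between in D1. pose proof (exp_pos x). nra. }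
  assert (Rabs ((exp x - 1) * sin y + (sin y - y)) <= 2 * (Rabs x * Rabs y) + y ^ 2).
  { eapply Rle_trans; [apply Rabs_triang|]. rewrite Rabs_mult.
    pose proof (Rabs_pos (exp x - 1)). pose proof (Rabs_pos (sin y)). nra. }
  nra.
Qed.

(** Both bounds are [ln y <= y - 1], at [y = n / (n + 1)] and at its inverse. *)
Lemma ln_ratio_bounds (n : nat) : (0 < n)%nat ->
  / INR (S n) <= ln (INR (S n)) - ln (INR n) <= / INR n.
Proof.
  intros Hn. assert (Hp : 0 < INR n) by (apply lt_0_INR; lia).
  rewrite S_INR.
  assert (K : forall y, 0 < y -> ln y <= y - 1).
  { intros y Hy. rewrite <- (ln_exp (y - 1)). apply ln_le; [lra|].
    pose proof (exp_ineq1_le (y - 1)). lra. }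
  split.
  - pose proof (K (INR n / (INR n + 1)) ltac:(apply Rdiv_lt_0_compat; lra)) as H.
    rewrite ln_div in H by lra.
    replace (INR n / (INR n + 1) - 1) with (- / (INR n + 1)) in H by (field; lra). lra.
  - pose proof (K ((INR n + 1) / INR n) ltac:(apply Rdiv_lt_0_compat; lra)) as H.
    rewrite ln_div in H by lra.
    replace ((INR n + 1) / INR n - 1) with (/ INR n) in H by (field; lra). lra.
Qed.

(* The weights [1/n - 1/(n+1)] telescope: [Cmod (Q n) * exp (M / n)] is nonincreasing. *)
Lemma cvg_of_summable_ratio (Q : nat -> C) (M : R) (N : nat) :
  0 <= M -> (0 < N)%nat ->
  (forall n, (N <= n)%nat ->
     Cmod (Q (S n) - Q n) <= M * (/ INR n - / INR (S n)) * Cmod (Q n)) ->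
  exists l, filterlim Q eventually (locally l).
Proof.
  intros HM HN H.
  assert (Hpos : forall n, (N <= n)%nat -> 0 < INR n) by (intros; apply lt_0_INR; lia).
  set (B := Cmod (Q N) * exp (M / INR N)).
  assert (HB : forall k, Cmod (Q (N + k)%nat) * exp (M / INR (N + k)) <= B).
  { induction k as [|k IH].
    - rewrite Nat.add_0_r. apply Rle_refl.
    - eapply Rle_trans; [|exact IH].
      replace (N + S k)%nat with (S (N + k)) by lia.
      set (n := (N + k)%nat) in *.
      pose proof (H n ltac:(lia)) as Hn.
      assert (T : Cmod (Q (S n)) <= Cmod (Q n) * (1 + M * (/ INR n - / INR (S n)))).
      { replace (Q (S n)) with (Q n + (Q (S n) - Q n))%C by ring.
        eapply Rle_trans; [apply Cmod_triangle|]. lra. }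
      pose proof (exp_ineq1_le (M * (/ INR n - / INR (S n)))) as E.
      replace (exp (M / INR n)) with
        (exp (M * (/ INR n - / INR (S n))) * exp (M / INR (S n)))
        by (rewrite <- exp_plus; f_equal; unfold Rdiv; ring).
      rewrite <- Rmult_assoc. apply Rmult_le_compat_r; [left; apply exp_pos|].
      eapply Rle_trans; [exact T|]. apply Rmult_le_compat_l; [apply Cmod_ge_0|exact E]. }
  assert (HB' : forall n, (N <= n)%nat -> Cmod (Q n) <= B).
  { intros n Hn. replace n with (N + (n - N))%nat by lia.
    eapply Rle_trans; [|apply HB].
    rewrite <- (Rmult_1_r (Cmod _)) at 1. apply Rmult_le_compat_l; [apply Cmod_ge_0|].
    pose proof (exp_ineq1_le (M / INR (N + (n - N)))).
    assert (0 <= M / INR (N + (n - N))); [|lra].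
    apply Rmult_le_pos; [auto|]. left; apply Rinv_0_lt_compat, Hpos; lia. }
  assert (HB0 : 0 <= B) by (eapply Rle_trans; [apply Cmod_ge_0 | apply (HB' N); lia]).
  assert (HD : forall n k, (N <= n)%nat ->
    Cmod (Q (n + k)%nat - Q n) <= M * B * (/ INR n - / INR (n + k))).
  { intros n k Hn. induction k as [|k IH].
    - rewrite Nat.add_0_r.
      replace (Q n - Q n)%C with (RtoC 0) by ring. rewrite Cmod_0. lra.
    - replace (n + S k)%nat with (S (n + k)) by lia.
      replace (Q (S (n + k)) - Q n)%C with
        ((Q (S (n + k)) - Q (n + k)%nat) + (Q (n + k)%nat - Q n))%C by ring.
      eapply Rle_trans; [apply Cmod_triangle|].
      pose proof (H (n + k)%nat ltac:(lia)) as H1.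
      pose proof (HB' (n + k)%nat ltac:(lia)) as H2.
      assert (0 <= / INR (n + k) - / INR (S (n + k))).
      { assert (/ INR (S (n + k)) <= / INR (n + k)); [|lra].
        apply Rinv_le_contravar; [apply Hpos; lia | apply le_INR; lia]. }
      assert (M * (/ INR (n + k) - / INR (S (n + k))) * Cmod (Q (n + k)%nat)
              <= M * (/ INR (n + k) - / INR (S (n + k))) * B)
        by (apply Rmult_le_compat_l; [apply Rmult_le_pos; auto | auto]).
      lra. }
  apply filterlim_C_cauchy. { apply eventually_filter. }
  intros eps He.
  assert (HMB : 0 <= M * B) by (apply Rmult_le_pos; auto).
  destruct (archimed_cor1 (eps / (2 * (M * B + 1)))) as [K [HK1 HK2]].
  { apply Rdiv_lt_0_compat; lra. }
  set (n0 := Nat.max N K).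
  assert (S0 : forall n, (n0 <= n)%nat -> Cmod (Q n - Q n0) < eps / 2).
  { intros n Hn. replace n with (n0 + (n - n0))%nat by lia.
    eapply Rle_lt_trans; [apply HD; lia|].
    assert (0 < / INR (n0 + (n - n0))) by (apply Rinv_0_lt_compat, Hpos; lia).
    assert (/ INR n0 <= / INR K).
    { apply Rinv_le_contravar; [apply lt_0_INR; lia | apply le_INR; lia]. }
    apply Rle_lt_trans with (M * B * (eps / (2 * (M * B + 1)))).
    - apply Rmult_le_compat_l; lra.
    - replace (eps / 2) with ((M * B + 1) * (eps / (2 * (M * B + 1)))) by (field; lra).
      apply Rmult_lt_compat_r; [|lra]. apply Rdiv_lt_0_compat; lra. }
  exists (fun n => (n0 <= n)%nat). split; [exists n0; auto|].
  intros u v Hu Hv.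
  replace (Q v - Q u)%C with ((Q v - Q n0) + - (Q u - Q n0))%C by ring.
  eapply Rle_lt_trans; [apply Cmod_triangle|]. rewrite Cmod_opp.
  pose proof (S0 u Hu). pose proof (S0 v Hv). lra.
Qed.

(** * Gauss approximants of the reciprocal Gamma function *)

Definition gauss (z : C) (n : nat) : C :=
  (Crising z n / (RtoC (INR (fact n)) * Rcpow (INR n) z))%C.

Lemma RtoC_neq_0 (x : R) : x <> 0 -> RtoC x <> 0.
Proof. intros H E. apply H. now apply RtoC_inj. Qed.

(** The ratio is [(1 + z / (n + 1)) (1 + 1 / n)^(- z) = 1 + O(n^(-2))]; the power is kept as a
    [Cexp] of a small argument so that the expansion at [0] applies. *)
Lemma gauss_step (z : C) (n : nat) :
  gauss z (S n) =
  (gauss z n * ((1 + z * RtoC (/ INR (S n))) *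
     Cexp (- z * RtoC (ln (INR (S n)) - ln (INR n)))))%C.
Proof.
  unfold gauss. cbn [Crising]. rewrite fact_simpl, mult_INR, RtoC_mult.
  assert (Hn : RtoC (INR (S n)) <> 0) by (apply RtoC_neq_0, not_0_INR; lia).
  assert (Hf : RtoC (INR (fact n)) <> 0) by (apply RtoC_neq_0, INR_fact_neq_0).
  assert (H1 : Rcpow (INR n) z <> 0) by apply Cexp_neq_0.
  assert (H2 : Rcpow (INR (S n)) z <> 0) by apply Cexp_neq_0.
  assert (E : Rcpow (INR n) z =
     (Rcpow (INR (S n)) z * Cexp (- z * RtoC (ln (INR (S n)) - ln (INR n))))%C).
  { unfold Rcpow. rewrite <- Cexp_plus. f_equal. rewrite RtoC_minus. ring. }
  rewrite RtoC_inv by (apply not_0_INR; lia).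
  replace (Cexp (- z * RtoC (ln (INR (S n)) - ln (INR n)))) with
    (Rcpow (INR n) z / Rcpow (INR (S n)) z)%C by (rewrite E; field; auto).
  field. auto.
Qed.

(** The first-order terms [z / (n + 1)] and [- z L], with [L = ln (n + 1) - ln n], cancel up to
    [1 / n - 1 / (n + 1)]. This telescoping difference is the unit in which all errors are measured,
    as the convergence criterion requires. *)
Lemma gauss_ratio_le (z : C) (n : nat) :
  (0 < n)%nat -> 2 * Cmod z <= INR n ->
  Cmod ((1 + z * RtoC (/ INR (S n))) * Cexp (- z * RtoC (ln (INR (S n)) - ln (INR n))) - 1)
  <= (Cmod z + 13 * Cmod z ^ 2) * (/ INR n - / INR (S n)).
Proof.
  intros Hn Hz. pose proof (ln_ratio_bounds n Hn) as HL.
  set (L := ln (INR (S n)) - ln (INR n)) in *.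
  assert (Hp : 0 < INR n) by (apply lt_0_INR; lia).
  assert (HS : INR (S n) = INR n + 1) by apply S_INR.
  assert (Hh0 : 0 < / INR (S n)) by (apply Rinv_0_lt_compat; lra).
  set (h := / INR (S n)) in *.
  assert (Hi0 : 0 < / INR n) by (apply Rinv_0_lt_compat; lra).
  assert (HD : / INR n - h = / INR n * h) by (unfold h; rewrite HS; field; lra).
  set (i := / INR n) in *.
  assert (Hii : i <= 2 * h).
  { unfold i, h. rewrite HS. assert (1 <= INR n) by (change 1 with (INR 1); apply le_INR; lia).
    apply Rmult_le_reg_l with (INR n * (INR n + 1)); [nra|]. field_simplify; lra. }
  pose proof (Cmod_ge_0 z) as Hz0.
  assert (Hzi : Cmod z * i <= 1 / 2).
  { unfold i. apply Rmult_le_reg_r with (INR n); [lra|]. rewrite Rmult_assoc, Rinv_l; lra. }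
  assert (HzL : Cmod (- z * RtoC L) <= Cmod z * i).
  { rewrite Cmod_mult, Cmod_opp, Cmod_R, Rabs_right by lra.
    apply Rmult_le_compat_l; lra. }
  pose proof (Cmod_Cexp_sub_le (- z * RtoC L) ltac:(lra)) as HR.
  set (Rm := (Cexp (- z * RtoC L) - 1 - (- z * RtoC L))%C) in *.
  (* The three terms contribute [|z|], [|z|^2] and [12 |z|^2], the last being [3/2] times [4] from
     the exponential times [2] from [i <= 2 h]; hence the constant [13]. *)
  replace ((1 + z * RtoC h) * Cexp (- z * RtoC L) - 1)%C with
    (- (z * RtoC (L - h)) + (- (z * z * RtoC (h * L)) + (1 + z * RtoC h) * Rm))%C
    by (unfold Rm; rewrite RtoC_minus, RtoC_mult; ring).
  eapply Rle_trans; [apply Cmod_triangle|].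
  eapply Rle_trans; [apply Rplus_le_compat_l, Cmod_triangle|].
  rewrite !Cmod_opp, !Cmod_mult, !Cmod_R.
  rewrite (Rabs_right (L - h)), (Rabs_right (h * L)) by nra.
  assert (H1 : Cmod (1 + z * RtoC h) <= 3 / 2).
  { eapply Rle_trans; [apply Cmod_triangle|].
    rewrite Cmod_mult, !Cmod_R, Rabs_R1, Rabs_right by lra.
    assert (Cmod z * h <= Cmod z * i) by (apply Rmult_le_compat_l; nra). lra. }
  assert (H2 : Cmod Rm <= 4 * (Cmod z ^ 2 * (i * (2 * h)))).
  { eapply Rle_trans; [exact HR|]. apply Rmult_le_compat_l; [lra|].
    pose proof (Cmod_ge_0 (- z * RtoC L)).
    apply Rle_trans with ((Cmod z * i) ^ 2); [apply pow_incr; lra|].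
    replace ((Cmod z * i) ^ 2) with (Cmod z ^ 2 * (i * i)) by ring.
    apply Rmult_le_compat_l; [apply pow2_ge_0|]. apply Rmult_le_compat_l; lra. }
  assert (H3 : Cmod (1 + z * RtoC h) * Cmod Rm <= 12 * (Cmod z ^ 2 * (i * h))).
  { pose proof (Cmod_ge_0 Rm). pose proof (Cmod_ge_0 (1 + z * RtoC h)). nra. }
  assert (H4 : Cmod z * (L - h) <= Cmod z * (i * h)) by (apply Rmult_le_compat_l; lra).
  assert (H5 : Cmod z * Cmod z * (h * L) <= Cmod z ^ 2 * (i * h)).
  { replace (Cmod z * Cmod z) with (Cmod z ^ 2) by ring.
    apply Rmult_le_compat_l; [apply pow2_ge_0|]. nra. }
  rewrite HD. lra.
Qed.

(** [rGamma] is defined by a choice of limit, so nothing can be said of it before the product is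
    known to converge. *)
Lemma gauss_cvg (z : C) : filterlim (gauss z) eventually (locally (rGamma z)).
Proof.
  destruct (INR_unbounded (2 * Cmod z)) as [N HN].
  set (M := Cmod z + 13 * Cmod z ^ 2).
  destruct (cvg_of_summable_ratio (gauss z) M (S N)) as [l Hl].
  - unfold M. pose proof (Cmod_ge_0 z). nra.
  - lia.
  - intros n Hn. rewrite gauss_step.
    match goal with |- Cmod (gauss z n * ?e - _) <= _ =>
      replace (gauss z n * e - gauss z n)%C with (gauss z n * (e - 1))%C by ring end.
    rewrite Cmod_mult, Rmult_comm. apply Rmult_le_compat_r; [apply Cmod_ge_0|].
    apply gauss_ratio_le; [lia|].
    assert (INR N <= INR n) by (apply le_INR; lia). lra.
  - unfold rGamma. change (filterlim (gauss z) eventually (locally (Clim (gauss z) eventually))).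
    rewrite (Clim_unique _ _ _ Hl). exact Hl.
Qed.

Lemma gauss_neq_0 (z : C) (n : nat) : 0 < Re z -> gauss z n <> 0.
Proof.
  intros Hz. unfold gauss. apply Cmult_neq_0.
  - assert (P : forall k, (z + RtoC (INR k))%C <> 0).
    { intros k E. apply (f_equal Re) in E. simpl in E. pose proof (pos_INR k). unfold Re in *. lra. }
    induction n as [|n IH]; cbn [Crising].
    + intros E. apply (f_equal Re) in E. simpl in E. lra.
    + apply Cmult_neq_0; auto.
  - assert (D0 : (RtoC (INR (fact n)) * Rcpow (INR n) z)%C <> 0)
      by (apply Cmult_neq_0; [apply RtoC_neq_0, INR_fact_neq_0 | apply Cexp_neq_0]).
    intros E. apply (RtoC_neq_0 1); [lra|]. rewrite <- (Cinv_r _ D0), E. ring.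
Qed.

(** The inverses of the approximants satisfy the same convergence criterion. Both limits exist and
    their product is [1], so neither can be [0]. *)
Lemma rGamma_neq_0 (z : C) : 0 < Re z -> rGamma z <> 0.
Proof.
  intros Hz H0.
  set (M := Cmod z + 13 * Cmod z ^ 2).
  assert (HM : 0 <= M) by (unfold M; pose proof (Cmod_ge_0 z); nra).
  (* The term [2 M] forces the ratio [e] of consecutive approximants to satisfy [|e - 1| <= 1/2],
     hence [|e| >= 1/2], and inverting it costs a factor [2] in the criterion. *)
  destruct (INR_unbounded (2 * Cmod z + 2 * M)) as [N HN].
  destruct (cvg_of_summable_ratio (fun n => / gauss z n)%C (2 * M) (S N)) as [l Hl].
  - lra.
  - lia.
  - intros n Hn.
    assert (HNn : INR N <= INR n) by (apply le_INR; lia).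
    pose proof (gauss_ratio_le z n ltac:(lia) ltac:(lra)) as HR.
    fold M in HR. pose proof (gauss_step z n) as E.
    set (e := ((1 + z * RtoC (/ INR (S n))) *
       Cexp (- z * RtoC (ln (INR (S n)) - ln (INR n))))%C) in *.
    set (D := / INR n - / INR (S n)) in *.
    assert (Hp : 0 < INR n) by (apply lt_0_INR; lia).
    assert (HD : 0 <= D <= / INR n).
    { unfold D. assert (0 < / INR (S n)) by (apply Rinv_0_lt_compat, lt_0_INR; lia).
      assert (/ INR (S n) <= / INR n) by (apply Rinv_le_contravar; [lra | apply le_INR; lia]).
      lra. }
    assert (HMD : M * D <= 1 / 2).
    { apply Rle_trans with (M * / INR n); [apply Rmult_le_compat_l; lra|].
      apply Rmult_le_reg_r with (INR n); [lra|]. rewrite Rmult_assoc, Rinv_l; pose proof (Cmod_ge_0 z); lra. }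
    assert (He : 1 / 2 <= Cmod e).
    { assert (Cmod 1 <= Cmod e + Cmod (e - 1)).
      { replace (RtoC 1) with (e + - (e - 1))%C at 1 by ring.
        eapply Rle_trans; [apply Cmod_triangle|]. rewrite Cmod_opp; lra. }
      rewrite Cmod_1 in *. lra. }
    assert (He0 : e <> 0) by (intros E0; rewrite E0, Cmod_0 in He; lra).
    pose proof (gauss_neq_0 z n Hz) as G0.
    replace (/ gauss z (S n) - / gauss z n)%C with (- ((e - 1) / e) * / gauss z n)%C
      by (rewrite E; field; auto).
    rewrite Cmod_mult. apply Rmult_le_compat_r; [apply Cmod_ge_0|].
    rewrite Cmod_opp, Cmod_div by auto.
    apply Rmult_le_reg_r with (Cmod e); [lra|].
    unfold Rdiv. rewrite Rmult_assoc, Rinv_l by lra.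
    assert (0 <= M * D) by (apply Rmult_le_pos; lra).
    nra.
  - pose proof (filterlim_Cmult eventually _ _ _ _ (gauss_cvg z) Hl) as H1.
    rewrite H0, Cmult_0_l in H1.
    assert (E : RtoC 0 = RtoC 1).
    { apply (filterlim_C_unique eventually _ _ _ H1).
      apply (filterlim_ext_loc (F := eventually) (fun _ => RtoC 1)).
      - exists 0%nat. intros n _. symmetry. apply Cinv_r. now apply gauss_neq_0.
      - exact (filterlim_const (RtoC 1)). }
    apply RtoC_inj in E. lra.
Qed.

Lemma filterlim_R_iff {T : Type} (F : (T -> Prop) -> Prop) {FF : Filter F}
  (f : T -> R) (l : R) :
  filterlim f F (locally l) <->
  forall eps, 0 < eps -> F (fun t => Rabs (f t - l) < eps).
Proof.
  rewrite filterlim_locally. split.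
  - intros H eps He. exact (H (mkposreal eps He)).
  - intros H eps. exact (H eps (cond_pos eps)).
Qed.

(** * Calculus for complex functions of a real variable *)

Definition is_Cderive (f : R -> C) (x : R) (l : C) : Prop :=
  is_derive (fun t => Re (f t)) x (Re l) /\ is_derive (fun t => Im (f t)) x (Im l).

Lemma is_Cderive_plus (f g : R -> C) (x : R) (l m : C) :
  is_Cderive f x l -> is_Cderive g x m -> is_Cderive (fun t => f t + g t)%C x (l + m)%C.
Proof.
  intros [A1 A2] [B1 B2]. split; simpl.
  - exact (is_derive_plus (V := R_NormedModule) _ _ _ _ _ A1 B1).
  - exact (is_derive_plus (V := R_NormedModule) _ _ _ _ _ A2 B2).
Qed.

Lemma is_derive_Rmult (f g : R -> R) (x l m : R) :
  is_derive f x l -> is_derive g x m -> is_derive (fun t => f t * g t) x (l * g x + f x * m).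
Proof.
  intros A B. apply (is_derive_mult f g x l m A B). intros; apply Rmult_comm.
Qed.

Lemma is_Cderive_mult (f g : R -> C) (x : R) (l m : C) :
  is_Cderive f x l -> is_Cderive g x m ->
  is_Cderive (fun t => f t * g t)%C x (l * g x + f x * m)%C.
Proof.
  intros [A1 A2] [B1 B2]. split; simpl.
  - replace (_ + _) with ((Re l * Re (g x) + Re (f x) * Re m)
      - (Im l * Im (g x) + Im (f x) * Im m)) by (unfold Re, Im; ring).
    exact (is_derive_minus (V := R_NormedModule) _ _ _ _ _
      (is_derive_Rmult _ _ _ _ _ A1 B1) (is_derive_Rmult _ _ _ _ _ A2 B2)).
  - replace (_ + _) with ((Re l * Im (g x) + Re (f x) * Im m)
      + (Im l * Re (g x) + Im (f x) * Re m)) by (unfold Re, Im; ring).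
    exact (is_derive_plus (V := R_NormedModule) _ _ _ _ _
      (is_derive_Rmult _ _ _ _ _ A1 B2) (is_derive_Rmult _ _ _ _ _ A2 B1)).
Qed.

Lemma is_Cderive_RtoC (f : R -> R) (x l : R) :
  is_derive f x l -> is_Cderive (fun t => RtoC (f t)) x (RtoC l).
Proof. intros A. split; simpl; [exact A|]. exact (is_derive_const (V := R_NormedModule) 0 x). Qed.

Lemma is_Cderive_const (c : C) (x : R) : is_Cderive (fun _ => c) x 0.
Proof. split; simpl; apply (is_derive_const (V := R_NormedModule)). Qed.

Lemma is_Cderive_Cexp (f : R -> C) (x : R) (l : C) :
  is_Cderive f x l -> is_Cderive (fun t => Cexp (f t)) x (l * Cexp (f x))%C.
Proof.
  intros [A1 A2].
  assert (E : is_derive (fun t => exp (Re (f t))) x (Re l * exp (Re (f x)))).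
  { apply (is_derive_comp exp (fun t => Re (f t))); [apply is_derive_exp | exact A1]. }
  assert (Co : is_derive (fun t => cos (Im (f t))) x (Im l * - sin (Im (f x)))).
  { apply (is_derive_comp cos (fun t => Im (f t))); [apply is_derive_cos | exact A2]. }
  assert (S : is_derive (fun t => sin (Im (f t))) x (Im l * cos (Im (f x)))).
  { apply (is_derive_comp sin (fun t => Im (f t))); [apply is_derive_sin | exact A2]. }
  split; simpl.
  - match goal with |- is_derive _ _ ?e => replace e with
      (Re l * exp (Re (f x)) * cos (Im (f x)) + exp (Re (f x)) * (Im l * - sin (Im (f x))))
      by (unfold Re, Im; ring) end.
    exact (is_derive_Rmult _ _ _ _ _ E Co).
  - match goal with |- is_derive _ _ ?e => replace e with
      (Re l * exp (Re (f x)) * sin (Im (f x)) + exp (Re (f x)) * (Im l * cos (Im (f x))))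
      by (unfold Re, Im; ring) end.
    exact (is_derive_Rmult _ _ _ _ _ E S).
Qed.

Definition Ccont (f : R -> C) (x : R) : Prop :=
  continuous (fun t => Re (f t)) x /\ continuous (fun t => Im (f t)) x.

Lemma is_Cderive_Ccont (f : R -> C) (x : R) (l : C) : is_Cderive f x l -> Ccont f x.
Proof.
  intros [A B]. split; apply (ex_derive_continuous (V := R_NormedModule)); eexists; eassumption.
Qed.

(** Componentwise, so that real calculus applies to each part; the two parts reassemble into the
    integral in the product module that [is_vertical_int] asks for. *)
Definition is_CInt (f : R -> C) (a b : R) (l : C) : Prop :=
  is_RInt (fun t => Re (f t)) a b (Re l) /\ is_RInt (fun t => Im (f t)) a b (Im l).

Definition CInt (f : R -> C) (a b : R) : C :=
  (RInt (fun t => Re (f t)) a b, RInt (fun t => Im (f t)) a b).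

Lemma is_CInt_unique (f : R -> C) (a b : R) (l : C) : is_CInt f a b l -> CInt f a b = l.
Proof.
  intros [A B]. unfold CInt. rewrite (is_RInt_unique _ _ _ _ A), (is_RInt_unique _ _ _ _ B).
  now destruct l.
Qed.

Lemma CInt_correct (f : R -> C) (a b : R) :
  a <= b -> (forall t, a <= t <= b -> Ccont f t) -> is_CInt f a b (CInt f a b).
Proof.
  intros Hab H. split; simpl; apply (RInt_correct (V := R_CompleteNormedModule));
    apply (ex_RInt_continuous (V := R_CompleteNormedModule));
    intros z Hz; rewrite Rmin_left, Rmax_right in Hz by auto; now apply H.
Qed.

Lemma is_CInt_plus (f g : R -> C) (a b : R) (l m : C) :
  is_CInt f a b l -> is_CInt g a b m -> is_CInt (fun t => f t + g t)%C a b (l + m)%C.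
Proof.
  intros [A1 A2] [B1 B2]. split.
  - exact (is_RInt_plus (V := R_NormedModule) _ _ _ _ _ _ A1 B1).
  - exact (is_RInt_plus (V := R_NormedModule) _ _ _ _ _ _ A2 B2).
Qed.

Lemma is_CInt_scal (f : R -> C) (a b : R) (c l : C) :
  is_CInt f a b l -> is_CInt (fun t => c * f t)%C a b (c * l)%C.
Proof.
  intros [A1 A2]. split.
  - exact (is_RInt_minus (V := R_NormedModule) _ _ _ _ _ _
      (is_RInt_scal (V := R_NormedModule) _ _ _ (Re c) _ A1)
      (is_RInt_scal (V := R_NormedModule) _ _ _ (Im c) _ A2)).
  - exact (is_RInt_plus (V := R_NormedModule) _ _ _ _ _ _
      (is_RInt_scal (V := R_NormedModule) _ _ _ (Re c) _ A2)
      (is_RInt_scal (V := R_NormedModule) _ _ _ (Im c) _ A1)).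
Qed.

Lemma is_CInt_ext (f g : R -> C) (a b : R) (l : C) :
  a <= b -> (forall t, a <= t <= b -> f t = g t) -> is_CInt f a b l -> is_CInt g a b l.
Proof.
  intros Hab H [A1 A2].
  split; [apply (is_RInt_ext (fun t => Re (f t))) | apply (is_RInt_ext (fun t => Im (f t)))];
    auto; intros t Ht; rewrite Rmin_left, Rmax_right in Ht by auto; rewrite H; auto; lra.
Qed.

Lemma CInt_Chasles (f : R -> C) (a b c : R) :
  a <= b <= c -> (forall t, a <= t <= c -> Ccont f t) ->
  (CInt f a c = CInt f a b + CInt f b c)%C.
Proof.
  intros Habc H. apply is_CInt_unique.
  destruct (CInt_correct f a b ltac:(lra) ltac:(intros; apply H; lra)) as [A1 A2].
  destruct (CInt_correct f b c ltac:(lra) ltac:(intros; apply H; lra)) as [B1 B2].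
  split.
  - exact (is_RInt_Chasles (V := R_NormedModule) _ _ _ _ _ _ A1 B1).
  - exact (is_RInt_Chasles (V := R_NormedModule) _ _ _ _ _ _ A2 B2).
Qed.

Lemma is_CInt_derive (f df : R -> C) (a b : R) :
  a <= b ->
  (forall t, a <= t <= b -> is_Cderive f t (df t)) ->
  (forall t, a <= t <= b -> Ccont df t) ->
  is_CInt df a b (f b - f a)%C.
Proof.
  intros Hab Hd Hc.
  split.
  - apply (is_RInt_derive (V := R_CompleteNormedModule) (fun t => Re (f t)));
      intros t Ht; rewrite Rmin_left, Rmax_right in Ht by auto; now apply Hd || now apply Hc.
  - apply (is_RInt_derive (V := R_CompleteNormedModule) (fun t => Im (f t)));
      intros t Ht; rewrite Rmin_left, Rmax_right in Ht by auto; now apply Hd || now apply Hc.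
Qed.

(** The norm of the product module is the Euclidean one, hence equal to [Cmod]; this avoids the
    constant lost by estimating the two parts separately. *)
Lemma Cmod_is_CInt_le (f : R -> C) (g : R -> R) (a b : R) (l : C) (m : R) :
  a <= b -> (forall t, a <= t <= b -> Cmod (f t) <= g t) ->
  is_CInt f a b l -> is_RInt g a b m -> Cmod l <= m.
Proof.
  intros Hab H Hf Hg.
  assert (N : forall z : C,
    norm (V := prod_NormedModule R_AbsRing R_NormedModule R_NormedModule) z = Cmod z).
  { intros [x y]. unfold norm; simpl. unfold prod_norm, Cmod, norm; simpl.
    unfold abs; simpl. f_equal. rewrite !Rmult_1_r, <- !Rabs_mult.
    rewrite !Rabs_right; try reflexivity; nra. }
  rewrite <- N.
  apply (norm_RInt_le (V := prod_NormedModule R_AbsRing R_NormedModule R_NormedModule)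
           f g a b l m Hab); [|destruct l, Hf; now apply is_RInt_fct_extend_pair | exact Hg].
  intros t Ht. rewrite N. auto.
Qed.

(** * The cosine integrals *)

Definition kern (r : R) (m : C) (th : R) : C :=
  (RtoC (cos (r * th)) * Rcpow (2 * cos th) m)%C.

(** An improper integral, because the kernel may be unbounded at [PI / 2] when [Re m < 0]. The [K s]
    of the overview is [kappa r (2 * s + r - 2)]. *)
Definition kappa (r : R) (m : C) : C :=
  Clim (fun b => CInt (kern r m) 0 b) (at_left (PI / 2)).

Lemma two_cos_pos (th : R) : 0 <= th < PI / 2 -> 0 < 2 * cos th.
Proof. intros H. assert (0 < cos th) by (apply cos_gt_0; lra). lra. Qed.

Lemma is_Cderive_Rcpow_cos (m : C) (th : R) : 0 < 2 * cos th ->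
  is_Cderive (fun t => Rcpow (2 * cos t) m) th
    (m * RtoC (- 2 * sin th / (2 * cos th)) * Rcpow (2 * cos th) m)%C.
Proof.
  intros H. unfold Rcpow. apply is_Cderive_Cexp.
  replace (m * RtoC (- 2 * sin th / (2 * cos th)))%C with
    (0 * RtoC (ln (2 * cos th)) + m * RtoC (- 2 * sin th / (2 * cos th)))%C by ring.
  apply (is_Cderive_mult (fun _ => m) (fun t => RtoC (ln (2 * cos t)))); [apply is_Cderive_const|].
  apply (is_Cderive_RtoC (fun t => ln (2 * cos t))). auto_derive; [exact H|]. field. lra.
Qed.

Lemma is_Cderive_kern (r : R) (m : C) (th : R) : 0 < 2 * cos th ->
  exists l, is_Cderive (kern r m) th l.
Proof.
  intros H. eexists. apply is_Cderive_mult.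
  - apply (is_Cderive_RtoC (fun t => cos (r * t))). auto_derive; [exact I | reflexivity].
  - now apply is_Cderive_Rcpow_cos.
Qed.

Lemma kern_Ccont (r : R) (m : C) (th : R) : 0 < 2 * cos th -> Ccont (kern r m) th.
Proof.
  intros H. destruct (is_Cderive_kern r m th H) as [l D]. exact (is_Cderive_Ccont _ _ _ D).
Qed.

Lemma kern_CInt_correct (r : R) (m : C) (a b : R) : 0 <= a <= b -> b < PI / 2 ->
  is_CInt (kern r m) a b (CInt (kern r m) a b).
Proof.
  intros Ha Hb. apply CInt_correct; [lra|].
  intros t Ht. apply kern_Ccont, two_cos_pos. lra.
Qed.

Lemma Cmod_kern_le (r : R) (m : C) (th : R) :
  Cmod (kern r m th) <= Rpower (2 * cos th) (Re m).
Proof.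
  unfold kern. rewrite Cmod_mult, Cmod_R, Cmod_Rcpow.
  assert (Rabs (cos (r * th)) <= 1) by (apply Rabs_le, COS_bound).
  assert (0 < Rpower (2 * cos th) (Re m)) by apply exp_pos.
  nra.
Qed.

(** For [a > 0], the integral of [2 sin t (2 cos t)^(a - 1)] from [b] to [PI / 2]: an explicit
    majorant for the part removed by a cutoff at [b]. *)
Definition tail (a b : R) : R := Rpower (2 * cos b) a / a.

Lemma tail_pos (a b : R) : 0 < a -> 0 < tail a b.
Proof. intros H. apply Rdiv_lt_0_compat; [apply exp_pos | exact H]. Qed.

Lemma is_RInt_tail (a b b' : R) : 0 < a -> 0 <= b <= b' -> b' < PI / 2 ->
  is_RInt (fun t => 2 * sin t * Rpower (2 * cos t) (a - 1)) b b' (tail a b - tail a b').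
Proof.
  intros Ha Hb Hb'.
  replace (tail a b - tail a b') with (minus (- tail a b') (- tail a b))
    by (unfold minus, plus, opp; simpl; ring).
  assert (Hc : forall t, Rmin b b' <= t <= Rmax b b' -> 0 < 2 * cos t).
  { intros t Ht. rewrite Rmin_left, Rmax_right in Ht by lra. apply two_cos_pos; lra. }
  apply (is_RInt_derive (V := R_CompleteNormedModule) (fun t => - tail a t)).
  - intros t Ht. specialize (Hc t Ht). unfold tail, Rpower. auto_derive; [exact Hc|].
    replace ((a - 1) * ln (2 * cos t)) with (a * ln (2 * cos t) + - ln (2 * cos t)) by ring.
    rewrite exp_plus, exp_Ropp, exp_ln by exact Hc. field. lra.
  - intros t Ht. specialize (Hc t Ht). unfold Rpower.
    apply (ex_derive_continuous (V := R_NormedModule)). auto_derive. exact Hc.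
Qed.

(* Beyond [PI / 6] one has [1 <= 2 sin], and [2 sin t (2 cos t)^(a - 1)] integrates exactly. *)
Lemma power_le_tail_integrand (a t : R) : PI / 6 <= t < PI / 2 ->
  Rpower (2 * cos t) (a - 1) <= 2 * sin t * Rpower (2 * cos t) (a - 1).
Proof.
  intros Ht. assert (0 < Rpower (2 * cos t) (a - 1)) by apply exp_pos.
  assert (1 / 2 <= sin t); [|nra].
  rewrite <- sin_PI6. pose proof PI_RGT_0.
  destruct (Req_dec (PI / 6) t) as [<-|]; [lra|].
  left. apply sin_increasing_1; lra.
Qed.

Lemma Cmod_CInt_kern_le_tail (r : R) (m : C) (b b' : R) :
  -1 < Re m -> PI / 6 <= b <= b' -> b' < PI / 2 ->
  Cmod (CInt (kern r m) b b') <= tail (Re m + 1) b.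
Proof.
  intros Hm Hb Hb'. pose proof PI_RGT_0.
  apply Rle_trans with (tail (Re m + 1) b - tail (Re m + 1) b');
    [|pose proof (tail_pos (Re m + 1) b' ltac:(lra)); lra].
  eapply Cmod_is_CInt_le;
    [| |apply kern_CInt_correct; lra | apply is_RInt_tail; lra]; [lra|].
  intros t Ht. eapply Rle_trans; [apply Cmod_kern_le|].
  replace (Re m) with (Re m + 1 - 1) at 1 by ring.
  apply power_le_tail_integrand. lra.
Qed.

Lemma at_left_PI2 (b : R) : b < PI / 2 -> at_left (PI / 2) (fun t => b < t < PI / 2).
Proof.
  intros H. exists (mkposreal (PI / 2 - b) ltac:(lra)). intros y Hy Hy'.
  unfold ball in Hy; simpl in Hy. unfold AbsRing_ball, abs, minus, plus, opp in Hy; simpl in Hy.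
  apply Rabs_lt_between in Hy. lra.
Qed.

Lemma filterlim_cos_power (a : R) : 0 < a ->
  filterlim (fun b => Rpower (2 * cos b) a) (at_left (PI / 2)) (locally 0).
Proof.
  intros Ha. apply (filterlim_R_iff (at_left (PI / 2))). intros eps He.
  set (d := Rpower eps (/ a)).
  assert (Hd : 0 < d) by apply exp_pos.
  assert (Hcos : filterlim (fun b => 2 * cos b) (at_left (PI / 2)) (locally (2 * cos (PI / 2)))).
  { eapply filterlim_filter_le_1.
    - apply filter_le_within.
    - apply (continuity_pt_filterlim (fun b => 2 * cos b)). reg. }
  rewrite cos_PI2, Rmult_0_r in Hcos.
  pose proof (proj1 (filterlim_R_iff (at_left (PI / 2)) _ _) Hcos d Hd) as H1.
  generalize (filter_and _ _ H1 (at_left_PI2 0 ltac:(pose proof PI_RGT_0; lra))).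
  apply filter_imp. intros b [Hb1 Hb2].
  pose proof (two_cos_pos b ltac:(lra)) as Hc.
  rewrite Rminus_0_r in *. rewrite Rabs_right in Hb1 by lra.
  rewrite Rabs_right by (left; apply exp_pos).
  replace eps with (Rpower d a).
  - apply Rlt_Rpower_l; lra.
  - unfold d. rewrite Rpower_mult, Rinv_l, Rpower_1; [reflexivity | exact He | lra].
Qed.

Lemma filterlim_tail (a : R) : 0 < a ->
  filterlim (tail a) (at_left (PI / 2)) (locally 0).
Proof.
  intros Ha. replace 0 with (0 * / a) by ring.
  apply (filterlim_Rmult (at_left (PI / 2)) _ (fun _ => / a)).
  - now apply filterlim_cos_power.
  - apply filterlim_const.
Qed.

Lemma kappa_lim (r : R) (m : C) : -1 < Re m ->
  filterlim (fun b => CInt (kern r m) 0 b) (at_left (PI / 2)) (locally (kappa r m)).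
Proof.
  intros Hm. pose proof PI_RGT_0.
  destruct (filterlim_C_cauchy (at_left (PI / 2)) (fun b => CInt (kern r m) 0 b)) as [l Hl].
  - intros eps He.
    assert (Hm' : 0 < Re m + 1) by lra.
    pose proof (proj1 (filterlim_R_iff (at_left (PI / 2)) _ _) (filterlim_tail _ Hm') eps He) as H1.
    exists (fun b => PI / 6 < b < PI / 2 /\ tail (Re m + 1) b < eps). split.
    + generalize (filter_and _ _ H1 (at_left_PI2 (PI / 6) ltac:(lra))).
      apply filter_imp. intros b [Hb1 Hb2]. split; [exact Hb2|].
      apply Rabs_lt_between in Hb1. lra.
    + assert (P : forall u v, PI / 6 < u -> u <= v -> v < PI / 2 -> tail (Re m + 1) u < eps ->
        Cmod (CInt (kern r m) 0 v - CInt (kern r m) 0 u) < eps).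
      { intros u v Hu Huv Hv Ht.
        rewrite (CInt_Chasles (kern r m) 0 u v) by
          (try lra; intros; apply kern_Ccont, two_cos_pos; lra).
        match goal with |- Cmod ?z < _ => replace z with (CInt (kern r m) u v) by ring end.
        eapply Rle_lt_trans; [apply Cmod_CInt_kern_le_tail|]; lra. }
      intros u v [Hu Tu] [Hv Tv]. destruct (Rle_dec u v).
      * apply P; lra.
      * replace (CInt (kern r m) 0 v - CInt (kern r m) 0 u)%C with
          (- (CInt (kern r m) 0 u - CInt (kern r m) 0 v))%C by ring.
        rewrite Cmod_opp. apply P; lra.
  - unfold kappa. rewrite (Clim_unique _ _ _ Hl). exact Hl.
Qed.

(** The bound sees [m] only through [Re m], so the cutoff error is uniform along a vertical line. *)
Lemma kappa_sub_le (r : R) (m : C) (b : R) : -1 < Re m -> PI / 6 <= b < PI / 2 ->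
  Cmod (kappa r m - CInt (kern r m) 0 b) <= tail (Re m + 1) b.
Proof.
  intros Hm Hb. pose proof PI_RGT_0.
  apply (Cmod_le_limit (at_left (PI / 2))
    (fun b' => CInt (kern r m) 0 b' + - CInt (kern r m) 0 b)%C (fun _ => tail (Re m + 1) b)).
  - apply (filterlim_Cplus (at_left (PI / 2))); [now apply kappa_lim|].
    exact (filterlim_const _).
  - apply filterlim_const.
  - generalize (at_left_PI2 b ltac:(lra)). apply filter_imp. intros b' Hb'.
    rewrite (CInt_Chasles (kern r m) 0 b b') by
      (try lra; intros; apply kern_Ccont, two_cos_pos; lra).
    match goal with |- Cmod ?z <= _ => replace z with (CInt (kern r m) b b') by ring end.
    apply Cmod_CInt_kern_le_tail; lra.
Qed.

(** The Wronskian [f' g - f g'] of [f = cos (r th)] and [g = (2 cos th)^m]. Its derivative is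
    [f'' g - f g''], where [f'' = - r^2 f] and [g'' = - m^2 g + 4 m (m - 1) (2 cos th)^(m - 2)];
    this packs the two integrations by parts into one primitive. *)
Definition kern_primitive (r : R) (m : C) (th : R) : C :=
  (RtoC (- r * sin (r * th)) * Rcpow (2 * cos th) m
   + (2 * m) * RtoC (cos (r * th) * sin th) * Rcpow (2 * cos th) (m - 1))%C.

Lemma is_Cderive_kern_primitive (r : R) (m : C) (th : R) : 0 < 2 * cos th ->
  is_Cderive (kern_primitive r m) th
    ((m * m - RtoC (r * r)) * kern r m th + - (4 * m * (m - 1)) * kern r (m - 2) th)%C.
Proof.
  intros Hc. unfold kern_primitive, kern.
  assert (Hc' : RtoC (2 * cos th) <> 0) by (apply RtoC_neq_0; lra).
  assert (E1 : Rcpow (2 * cos th) m = (Rcpow (2 * cos th) (m - 2) *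
     (RtoC (2 * cos th) * RtoC (2 * cos th)))%C).
  { rewrite <- (Rcpow_1 (2 * cos th) Hc). rewrite <- !Rcpow_plus. f_equal. ring. }
  assert (E2 : Rcpow (2 * cos th) (m - 1) = (Rcpow (2 * cos th) (m - 2) * RtoC (2 * cos th))%C).
  { rewrite <- (Rcpow_1 (2 * cos th) Hc). rewrite <- !Rcpow_plus. f_equal. ring. }
  assert (HS : (RtoC (sin th) * RtoC (sin th) = 1 - RtoC (cos th) * RtoC (cos th))%C).
  { rewrite <- !RtoC_mult, <- RtoC_minus. f_equal.
    pose proof (sin2_cos2 th) as H. unfold Rsqr in H. lra. }
  eassert (H : is_Cderive _ th _).
  { apply is_Cderive_plus.
    - apply is_Cderive_mult; [|apply (is_Cderive_Rcpow_cos m th Hc)].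
      apply (is_Cderive_RtoC (fun t => - r * sin (r * t)) th (- r * (r * cos (r * th)))).
      auto_derive; [exact I | ring].
    - apply is_Cderive_mult; [|apply (is_Cderive_Rcpow_cos (m - 1) th Hc)].
      apply is_Cderive_mult; [apply (is_Cderive_const (2 * m))|].
      apply (is_Cderive_RtoC (fun t => cos (r * t) * sin t) th
        (- r * sin (r * th) * sin th + cos (r * th) * cos th)).
      auto_derive; [exact I | ring]. }
  match type of H with is_Cderive _ _ ?e => match goal with |- is_Cderive _ _ ?e' =>
    replace e' with e; [exact H|] end end.
  rewrite E1, E2.
  rewrite !RtoC_div by lra. rewrite ?RtoC_plus, ?RtoC_mult, ?RtoC_opp, ?RtoC_mult.
  set (c := RtoC (cos th)) in *. set (s := RtoC (sin th)) in *.
  assert (Hc0 : c <> 0) by (apply RtoC_neq_0; lra).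
  match goal with |- ?L = ?R => transitivity (L + 0)%C; [ring|] end.
  set (X := Rcpow (2 * cos th) (m - 2)). set (a := RtoC (cos (r * th))).
  set (b := RtoC (sin (r * th))).
  (* All powers are reduced to [X], so after clearing [c] the claim is polynomial and needs only
     [s * s = 1 - c * c]. *)
  transitivity (X * (- RtoC r * RtoC r * a * (4 * c * c) + 2 * m * a * c * (2 * c)
     - 4 * m * (m - 1) * a * (s * s)))%C.
  - field. exact Hc0.
  - rewrite HS. ring.
Qed.

(** No boundary term survives: the Wronskian vanishes at [0] with the sines, and at [PI / 2] because
    both exponents [Re m] and [Re m - 1] are positive. *)
Lemma kappa_rec (r : R) (m : C) : 1 < Re m ->
  ((m * m - RtoC (r * r)) * kappa r m = 4 * m * (m - 1) * kappa r (m - 2))%C.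
Proof.
  intros Hm. pose proof PI_RGT_0.
  assert (L : filterlim (fun b => (m * m - RtoC (r * r)) * CInt (kern r m) 0 b
      + - (4 * m * (m - 1)) * CInt (kern r (m - 2)) 0 b)%C (at_left (PI / 2))
      (locally ((m * m - RtoC (r * r)) * kappa r m + - (4 * m * (m - 1)) * kappa r (m - 2))%C)).
  { apply (filterlim_Cplus (at_left (PI / 2))); apply (filterlim_Cmult (at_left (PI / 2)));
      try exact (filterlim_const _); apply kappa_lim; unfold Re in *; simpl; lra. }
  assert (P : at_left (PI / 2) (fun b => ((m * m - RtoC (r * r)) * CInt (kern r m) 0 b
      + - (4 * m * (m - 1)) * CInt (kern r (m - 2)) 0 b)%C = kern_primitive r m b)).
  { generalize (at_left_PI2 0 ltac:(lra)). apply filter_imp. intros b Hb.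
    transitivity (CInt (fun t => (m * m - RtoC (r * r)) * kern r m t
       + - (4 * m * (m - 1)) * kern r (m - 2) t)%C 0 b).
    - symmetry. apply is_CInt_unique, is_CInt_plus; apply is_CInt_scal, kern_CInt_correct; lra.
    - apply is_CInt_unique.
      replace (kern_primitive r m b) with (kern_primitive r m b - kern_primitive r m 0)%C.
      + apply is_CInt_derive; [lra | |].
        * intros t Ht. apply is_Cderive_kern_primitive, two_cos_pos. lra.
        * intros t Ht. assert (Hc : 0 < 2 * cos t) by (apply two_cos_pos; lra).
          destruct (is_Cderive_kern r m t Hc) as [l1 D1].
          destruct (is_Cderive_kern r (m - 2) t Hc) as [l2 D2].
          exact (is_Cderive_Ccont _ _ _ (is_Cderive_plus _ _ _ _ _
            (is_Cderive_mult _ _ _ _ _ (is_Cderive_const _ t) D1)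
            (is_Cderive_mult _ _ _ _ _ (is_Cderive_const _ t) D2))).
      + unfold kern_primitive. rewrite Rmult_0_r, sin_0, !Rmult_0_r. ring. }
  assert (Z : filterlim (kern_primitive r m) (at_left (PI / 2)) (locally (RtoC 0))).
  { apply (filterlim_Cmod (at_left (PI / 2))). intros eps He.
    assert (HB : filterlim (fun b => Rabs r * Rpower (2 * cos b) (Re m)
       + 2 * Cmod m * Rpower (2 * cos b) (Re m - 1)) (at_left (PI / 2)) (locally (Rabs r * 0 + 2 * Cmod m * 0))).
    { apply (filterlim_Rplus (at_left (PI / 2))); apply (filterlim_Rmult (at_left (PI / 2)));
        try apply filterlim_const; apply filterlim_cos_power; lra. }
    rewrite !Rmult_0_r, Rplus_0_r in HB.
    generalize (proj1 (filterlim_R_iff (at_left (PI / 2)) _ _) HB eps He).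
    apply filter_imp. intros b Hb.
    rewrite Rminus_0_r in Hb. eapply Rle_lt_trans; [|exact Hb].
    eapply Rle_trans; [|apply Rle_abs].
    replace (kern_primitive r m b - 0)%C with (kern_primitive r m b) by ring.
    unfold kern_primitive. eapply Rle_trans; [apply Cmod_triangle|].
    rewrite !Cmod_mult, !Cmod_R, !Cmod_Rcpow, !Rabs_mult, Rabs_Ropp, (Rabs_right 2) by lra.
    assert (Rabs (sin (r * b)) <= 1) by (apply Rabs_le, SIN_bound).
    assert (Rabs (sin b) <= 1) by (apply Rabs_le, SIN_bound).
    assert (Rabs (cos (r * b)) <= 1) by (apply Rabs_le, COS_bound).
    pose proof (Rabs_pos r). pose proof (Cmod_ge_0 m).
    pose proof (Rabs_pos (sin (r * b))). pose proof (Rabs_pos (sin b)).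
    pose proof (Rabs_pos (cos (r * b))).
    assert (R1 : 0 < Rpower (2 * cos b) (Re m)) by apply exp_pos.
    replace (Re (m - 1)%C) with (Re m - 1) by (simpl; unfold Re; ring).
    assert (R2 : 0 < Rpower (2 * cos b) (Re m - 1)) by apply exp_pos.
    apply Rplus_le_compat; apply Rmult_le_compat_r; try lra; [nra|].
    rewrite <- (Rmult_1_r (2 * Cmod m)) at 2. apply Rmult_le_compat_l; [lra|nra]. }
  pose proof (filterlim_C_unique (at_left (PI / 2)) _ _ _ (filterlim_ext_loc _ _ P L) Z) as E.
  match type of E with (?X + - ?Y * ?W)%C = _ =>
    transitivity ((X + - Y * W) + Y * W)%C; [ring | rewrite E; ring] end.
Qed.

(** The Wallis integral of [(2 cos t)^(2 n)] over a quarter period: [PI / 2] times the central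
    binomial coefficient. *)
Definition wallis (n : nat) : R := PI / 2 * (INR (fact (2 * n)) / (INR (fact n) * INR (fact n))).

Lemma wallis_pos (n : nat) : 0 < wallis n.
Proof.
  pose proof PI_RGT_0. pose proof (INR_fact_lt_0 n). pose proof (INR_fact_lt_0 (2 * n)).
  apply Rmult_lt_0_compat; [lra|]. apply Rdiv_lt_0_compat; nra.
Qed.

Lemma wallis_S (n : nat) : wallis (S n) = wallis n * (4 * (2 * INR n + 1) / (2 * INR n + 2)).
Proof.
  unfold wallis. replace (2 * S n)%nat with (S (S (2 * n))) by lia.
  rewrite !fact_simpl, !mult_INR, !S_INR, mult_INR. simpl (INR 2).
  pose proof (pos_INR n). pose proof (INR_fact_neq_0 n). field. repeat split; auto; lra.
Qed.

(** At [r = 0] a factor [m] cancels from the two-step recurrence, leaving the Wallis recurrence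
    started at the integral of [1]. *)
Lemma kappa_wallis (n : nat) : kappa 0 (RtoC (2 * INR n)) = RtoC (wallis n).
Proof.
  pose proof PI_RGT_0.
  induction n as [|n IH].
  - apply Clim_unique.
    { apply at_left_proper_filter. }
    unfold wallis. simpl (INR _). simpl (fact _).
    apply (filterlim_ext_loc (F := (at_left (PI / 2))) (fun b => RtoC b)).
    + generalize (at_left_PI2 0 ltac:(lra)). apply filter_imp. intros b Hb.
      symmetry. apply is_CInt_unique.
      apply (is_CInt_ext (fun _ => RtoC 1)); [lra| |].
      * intros t _. unfold kern, Rcpow. rewrite Rmult_0_l, cos_0, Rmult_0_r, Cmult_0_l, Cexp_0. ring.
      * assert (K : forall v, is_RInt (fun _ => v) 0 b ((b - 0) * v))
          by (intros v; exact (is_RInt_const (V := R_NormedModule) 0 b v)).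
        split; simpl.
        -- generalize (K 1). now rewrite Rmult_1_r, Rminus_0_r.
        -- generalize (K 0). now rewrite Rmult_0_r.
    + replace (PI / 2 * (1 / (1 * 1))) with (PI / 2) by field.
      apply (filterlim_RtoC (at_left (PI / 2))).
      eapply filterlim_filter_le_1; [apply filter_le_within | apply filterlim_id].
  - pose proof (pos_INR n) as Hn.
    set (m := RtoC (2 * INR (S n))).
    assert (Hm : 1 < Re m) by (unfold m, Re, RtoC; rewrite S_INR; simpl; lra).
    pose proof (kappa_rec 0 m Hm) as E.
    replace (m - 2)%C with (RtoC (2 * INR n)) in E
      by (unfold m; rewrite S_INR, <- RtoC_minus; f_equal; ring).
    rewrite IH in E. rewrite wallis_S.
    assert (M0 : m <> 0) by (apply RtoC_neq_0; change (1 < 2 * INR (S n)) in Hm; lra).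
    rewrite Rmult_0_l in E.
    assert (E2 : (m * (m * kappa 0 m) = m * (4 * (m - 1) * RtoC (wallis n)))%C).
    { transitivity ((m * m - RtoC 0) * kappa 0 m)%C; [ring | rewrite E; ring]. }
    transitivity ((m * (m * kappa 0 m)) / (m * m))%C; [field; exact M0|].
    rewrite E2. unfold m in *. rewrite S_INR in *.
    transitivity (RtoC (4 * (2 * (INR n + 1) - 1) * wallis n / (2 * (INR n + 1)))).
    + rewrite RtoC_div, !RtoC_mult, RtoC_minus, !RtoC_mult by lra.
      field.
      apply RtoC_neq_0; lra.
    + f_equal. field. lra.
Qed.

(** * Asymptotics of the cosine integrals for large exponents *)

Lemma kern_shift (r : R) (m : C) (a th : R) :
  kern r (m + RtoC a) th = (RtoC (Rpower (2 * cos th) a) * kern r m th)%C.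
Proof.
  unfold kern. rewrite Rcpow_plus.
  replace (Rcpow (2 * cos th) (RtoC a)) with (RtoC (Rpower (2 * cos th) a)); [ring|].
  unfold Rcpow, Rpower. rewrite <- RtoC_mult, Cexp_RtoC. reflexivity.
Qed.

Lemma kern_0_real (a th : R) : kern 0 (RtoC a) th = RtoC (Rpower (2 * cos th) a).
Proof.
  replace (RtoC a) with (0 + RtoC a)%C by ring. rewrite kern_shift.
  unfold kern, Rcpow. rewrite Rmult_0_l, cos_0, Cmult_0_l, Cexp_0. ring.
Qed.

(** Continuity at [0] gives [eps] for small angles; elsewhere [sin th] is bounded below and a large
    [K] absorbs the sup bound [2 * Rpower 2 (Re m)]. The error is measured by [sin th ^ 2] because
    its weighted integrals are known exactly. *)
Lemma kern_near_0 (r : R) (m : C) (eps : R) : 0 < Re m -> 0 < eps ->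
  exists K, 0 <= K /\ forall th, 0 <= th < PI / 2 ->
    Cmod (kern r m th - Rcpow 2 m) <= eps + K * sin th ^ 2.
Proof.
  intros Hm He. pose proof PI_RGT_0.
  assert (K0 : kern r m 0 = Rcpow 2 m).
  { unfold kern. rewrite Rmult_0_r, cos_0, Rmult_1_r. ring. }
  assert (L : filterlim (kern r m) (locally 0) (locally (kern r m 0))).
  { destruct (kern_Ccont r m 0) as [A B]; [rewrite cos_0; lra|].
    apply (filterlim_C_pair (locally 0)); [exact A | exact B]. }
  pose proof (proj1 (filterlim_Cmod (locally 0) _ _) L eps He) as [d Hd].
  rewrite K0 in Hd.
  set (dl := Rmin (d / 2) (PI / 4)).
  assert (Hdl : 0 < dl /\ dl < d /\ dl < PI / 2).
  { unfold dl. pose proof (cond_pos d). unfold Rmin. destruct Rle_dec; lra. }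
  assert (Hs : 0 < sin dl) by (apply sin_gt_0; lra).
  set (M := 2 * Rpower 2 (Re m)).
  assert (HM : 0 < M) by (unfold M; pose proof (exp_pos (Re m * ln 2)); unfold Rpower; lra).
  exists (M / sin dl ^ 2). split.
  { apply Rmult_le_pos; [lra|]. left; apply Rinv_0_lt_compat. nra. }
  intros th Hth. destruct (Rle_dec dl th) as [Hl|Hl].
  - assert (sin dl <= sin th).
    { destruct (Req_dec dl th) as [<-|]; [lra|]. left. apply sin_increasing_1; lra. }
    apply Rle_trans with (M / sin dl ^ 2 * sin dl ^ 2).
    + replace (M / sin dl ^ 2 * sin dl ^ 2) with M by (field; lra).
      unfold Cminus. eapply Rle_trans; [apply Cmod_triangle|].
      rewrite Cmod_opp, Cmod_Rcpow. pose proof (Cmod_kern_le r m th) as H1.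
      assert (Rpower (2 * cos th) (Re m) <= Rpower 2 (Re m)).
      { apply Rle_Rpower_l; [lra|]. pose proof (two_cos_pos th Hth).
        pose proof (COS_bound th). lra. }
      unfold M. lra.
    + assert (M / sin dl ^ 2 * sin dl ^ 2 <= M / sin dl ^ 2 * sin th ^ 2); [|lra].
      apply Rmult_le_compat_l; [|apply pow_incr; lra].
      apply Rmult_le_pos; [lra|]. left; apply Rinv_0_lt_compat. nra.
  - assert (Cmod (kern r m th - Rcpow 2 m) < eps).
    { apply Hd. unfold ball; simpl. unfold AbsRing_ball, abs, minus, plus, opp; simpl.
      rewrite Ropp_0, Rplus_0_r, Rabs_right; lra. }
    assert (0 <= M / sin dl ^ 2 * sin th ^ 2); [|lra].
    apply Rmult_le_pos; [|nra]. apply Rmult_le_pos; [lra|].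
    left; apply Rinv_0_lt_compat. nra.
Qed.

(* The weights [(2 cos th)^(2n)] concentrate at [0]: the mass they give to [sin^2] is
   [wallis n - wallis (n + 1) / 4 = wallis n / (2n + 2)]. *)
Lemma kappa_concentration_le (r : R) (m : C) (eps : R) : 0 < Re m -> 0 < eps ->
  exists K, 0 <= K /\ forall n,
    Cmod (kappa r (m + RtoC (2 * INR n)) - Rcpow 2 m * RtoC (wallis n))
    <= wallis n * (eps + K / (2 * INR n + 2)).
Proof.
  intros Hm He. pose proof PI_RGT_0.
  destruct (kern_near_0 r m eps Hm He) as [K [HK0 HK]].
  exists K. split; [exact HK0|]. intros n. pose proof (pos_INR n) as Hn.
  rewrite <- kappa_wallis.
  apply (Cmod_le_limit (at_left (PI / 2))
    (fun b => CInt (kern r (m + RtoC (2 * INR n))) 0 b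
       + - Rcpow 2 m * CInt (kern 0 (RtoC (2 * INR n))) 0 b)%C
    (fun b => (eps + K) * Re (CInt (kern 0 (RtoC (2 * INR n))) 0 b)
       + - (K / 4) * Re (CInt (kern 0 (RtoC (2 * INR (S n)))) 0 b))).
  - replace (kappa r (m + RtoC (2 * INR n)) - Rcpow 2 m * kappa 0 (RtoC (2 * INR n)))%C with
      (kappa r (m + RtoC (2 * INR n)) + - Rcpow 2 m * kappa 0 (RtoC (2 * INR n)))%C by ring.
    apply (filterlim_Cplus (at_left (PI / 2))).
    + apply kappa_lim. simpl. unfold Re in *. lra.
    + apply (filterlim_Cmult (at_left (PI / 2))); [exact (filterlim_const _)|].
      apply kappa_lim. simpl. lra.
  - replace (wallis n * (eps + K / (2 * INR n + 2))) with
      ((eps + K) * Re (kappa 0 (RtoC (2 * INR n))) + - (K / 4) * Re (kappa 0 (RtoC (2 * INR (S n)))))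
      by (rewrite !kappa_wallis; simpl Re; rewrite wallis_S; field; lra).
    apply (filterlim_Rplus (at_left (PI / 2))); apply (filterlim_Rmult (at_left (PI / 2)));
      try apply filterlim_const; apply (filterlim_Re (at_left (PI / 2))), kappa_lim;
      unfold Re, RtoC, fst; pose proof (pos_INR (S n)); lra.
  - generalize (at_left_PI2 0 ltac:(lra)). apply filter_imp. intros b Hb.
    destruct (kern_CInt_correct 0 (RtoC (2 * INR n)) 0 b ltac:(lra) ltac:(lra)) as [A _].
    destruct (kern_CInt_correct 0 (RtoC (2 * INR (S n))) 0 b ltac:(lra) ltac:(lra)) as [B _].
    apply (Cmod_is_CInt_le (fun t => kern r (m + RtoC (2 * INR n)) t
        + - Rcpow 2 m * kern 0 (RtoC (2 * INR n)) t)%C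
      (fun t => (eps + K) * Re (kern 0 (RtoC (2 * INR n)) t)
        + - (K / 4) * Re (kern 0 (RtoC (2 * INR (S n))) t)) 0 b).
    + lra.
    + intros t Ht. rewrite kern_shift, !kern_0_real. rewrite !re_RtoC.
      pose proof (two_cos_pos t ltac:(lra)) as Hc.
      set (p := Rpower (2 * cos t) (2 * INR n)).
      assert (Hp : 0 < p) by apply exp_pos.
      assert (E : Rpower (2 * cos t) (2 * INR (S n)) = p * (4 * (1 - sin t ^ 2))).
      { rewrite S_INR. replace (2 * (INR n + 1)) with (2 * INR n + 1 + 1) by ring.
        rewrite !Rpower_plus, Rpower_1 by exact Hc. fold p.
        pose proof (sin2_cos2 t) as Hs. unfold Rsqr in Hs.
        replace (1 - sin t ^ 2) with (cos t * cos t) by (simpl; lra). ring. }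
      rewrite E.
      replace (RtoC p * kern r m t + - Rcpow 2 m * RtoC p)%C with
        (RtoC p * (kern r m t - Rcpow 2 m))%C by ring.
      rewrite Cmod_mult, Cmod_R, Rabs_right by lra.
      specialize (HK t ltac:(lra)).
      replace ((eps + K) * p + - (K / 4) * (p * (4 * (1 - sin t ^ 2)))) with
        (p * (eps + K * sin t ^ 2)) by field.
      apply Rmult_le_compat_l; lra.
    + apply is_CInt_plus; [|apply is_CInt_scal]; apply kern_CInt_correct; lra.
    + exact (is_RInt_plus (V := R_NormedModule) _ _ _ _ _ _
        (is_RInt_scal (V := R_NormedModule) _ _ _ (eps + K) _ A)
        (is_RInt_scal (V := R_NormedModule) _ _ _ (- (K / 4)) _ B)).
Qed.

Lemma kappa_div_wallis_lim (r : R) (m : C) : 0 < Re m ->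
  filterlim (fun n : nat => kappa r (m + RtoC (2 * INR n)) / RtoC (wallis n))%C
    eventually (locally (Rcpow 2 m)).
Proof.
  intros Hm. apply (filterlim_Cmod eventually). intros eps He.
  destruct (kappa_concentration_le r m (eps / 2) Hm ltac:(lra)) as [K [HK0 HK]].
  destruct (INR_unbounded (K / eps)) as [N HN].
  exists N. intros n Hn. apply le_INR in Hn.
  pose proof (wallis_pos n) as Hw. assert (Hw0 : RtoC (wallis n) <> 0) by (apply RtoC_neq_0; lra).
  replace (kappa r (m + RtoC (2 * INR n)) / RtoC (wallis n) - Rcpow 2 m)%C with
    ((kappa r (m + RtoC (2 * INR n)) - Rcpow 2 m * RtoC (wallis n)) / RtoC (wallis n))%C
    by (field; exact Hw0).
  rewrite Cmod_div, Cmod_R, Rabs_right by (auto; lra).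
  apply Rmult_lt_reg_r with (wallis n); [exact Hw|].
  unfold Rdiv at 1. rewrite Rmult_assoc, Rinv_l, Rmult_1_r by lra.
  eapply Rle_lt_trans; [apply HK|]. rewrite (Rmult_comm eps). apply Rmult_lt_compat_l; [exact Hw|].
  assert (K / (2 * INR n + 2) < eps / 2); [|lra].
  pose proof (pos_INR n).
  assert (K < INR n * eps).
  { apply Rmult_lt_reg_r with (/ eps); [now apply Rinv_0_lt_compat|].
    rewrite Rmult_assoc, Rinv_r, Rmult_1_r by lra. unfold Rdiv in HN. lra. }
  apply Rmult_lt_reg_r with (2 * INR n + 2); [lra|].
  unfold Rdiv at 1. rewrite Rmult_assoc, Rinv_l by lra. lra.
Qed.

(** At [m = w + 1 + 2 n = 2 s + r + 2 n] the recurrence has coefficients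
    [m^2 - r^2 = 4 (s + n) (s + r + n)] and [4 m (m - 1) = 4 (w + 2 n + 1) (w + 2 n)]. Each step
    thus adds one factor to the first two rising factorials and two to the third, which explains the
    index [2 * n + 1]. *)
Lemma Crising_kappa (r : R) (s : C) (n : nat) :
  let w := (2 * s + RtoC r - 1)%C in 0 < Re w ->
  (Crising s n * Crising (s + RtoC r) n * kappa r (w + 1 + RtoC (2 * INR n))
   = Crising w (2 * n + 1) * kappa r (w - 1))%C.
Proof.
  intros w Hw. induction n as [|n IH].
  - simpl (2 * 0 + 1)%nat. cbn [Crising].
    replace (w + 1 + RtoC (2 * INR 0))%C with (w + 1)%C by (change (INR 0) with 0; rewrite Rmult_0_r; ring).
    pose proof (kappa_rec r (w + 1) ltac:(change (1 < Re w + 1); lra)) as E.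
    replace (w + 1 - 2)%C with (w - 1)%C in E by ring.
    transitivity (((w + 1) * (w + 1) - RtoC (r * r)) * kappa r (w + 1) / 4)%C.
    + rewrite RtoC_mult. unfold w. field.
    + rewrite E. simpl (INR 1). field.
  - replace (2 * S n + 1)%nat with (S (S (2 * n + 1))) by lia.
    cbn [Crising].
    set (m := (w + 1 + RtoC (2 * INR (S n)))%C).
    pose proof (pos_INR n) as Hn.
    pose proof (kappa_rec r m) as E.
    replace (m - 2)%C with (w + 1 + RtoC (2 * INR n))%C in E
      by (unfold m; rewrite S_INR, !RtoC_mult, RtoC_plus; ring).
    specialize (E ltac:(change (1 < Re w + 1 + 2 * INR (S n)); rewrite S_INR; lra)).
    transitivity (Crising s n * Crising (s + RtoC r) n *
      ((m * m - RtoC (r * r)) * kappa r m) / 4)%C.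
    + rewrite RtoC_mult. unfold m, w. rewrite !RtoC_mult. field.
    + rewrite E.
      transitivity ((Crising s n * Crising (s + RtoC r) n * kappa r (w + 1 + RtoC (2 * INR n)))
        * (m * (m - 1)))%C; [field|].
      assert (I1 : INR (S (2 * n + 1)) = 2 * INR n + 2)
        by (rewrite S_INR, plus_INR, mult_INR; simpl; ring).
      assert (I2 : INR (S (S (2 * n + 1))) = 2 * INR n + 3) by (rewrite S_INR, I1; ring).
      rewrite IH, I1, I2. unfold m. rewrite S_INR, !RtoC_mult, !RtoC_plus, !RtoC_mult. ring.
Qed.

(** * Cauchy's formula from the Gauss approximants *)

Lemma INR_ratio_lim :
  filterlim (fun n : nat => INR n / INR (2 * n + 1)) eventually (locally (/ 2)).
Proof.
  apply (filterlim_R_iff eventually). intros eps He.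
  destruct (archimed_cor1 eps He) as [N [HN HN0]].
  exists N. intros n Hn.
  assert (H1 : INR N <= INR n) by (apply le_INR; exact Hn).
  assert (H0 : 0 < INR N) by (apply lt_0_INR; lia).
  rewrite plus_INR, mult_INR. change (INR 2) with 2; change (INR 1) with 1.
  replace (INR n / (2 * INR n + 1) - / 2) with (- / (2 * (2 * INR n + 1))) by (field; lra).
  rewrite Rabs_Ropp, Rabs_right by (left; apply Rinv_0_lt_compat; lra).
  eapply Rle_lt_trans; [|exact HN]. apply Rinv_le_contravar; lra.
Qed.

(* Cauchy's formula for [int_0^(PI/2) cos (r t) (2 cos t)^(w - 1) dt]. *)
Lemma kappa_rGamma (r : R) (s : C) :
  let w := (2 * s + RtoC r - 1)%C in 0 < Re w ->
  (rGamma s * rGamma (s + RtoC r) * RtoC (PI / 2) = rGamma w * kappa r (w - 1))%C.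
Proof.
  intros w Hw. pose proof PI_RGT_0.
  (* [X n] is the factor for which [gauss s n * gauss (s + r) n * X n] equals
     [gauss w (2 * n + 1) * kappa r (w - 1)]. The ratio [n / (2 n + 1)] arises because the
     approximants are taken at different indices. Its limit contributes [2^(- w - 1)], which cancels
     the limit [2^(w + 1)] of the cosine integrals and leaves [PI / 2]. *)
  set (X := fun n : nat => (RtoC (PI / 2) * (RtoC (INR n / INR (2 * n + 1)) *
     Rcpow (INR n / INR (2 * n + 1)) w) *
     (kappa r (w + 1 + RtoC (2 * INR n)) / RtoC (wallis n)))%C).
  assert (LX : filterlim X eventually
     (locally (RtoC (PI / 2) * (RtoC (/ 2) * Rcpow (/ 2) w) * Rcpow 2 (w + 1))%C)).
  { apply (filterlim_Cmult eventually).
    - apply (filterlim_Cmult eventually); [exact (filterlim_const _)|].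
      apply (filterlim_Cmult eventually).
      + apply (filterlim_RtoC eventually), INR_ratio_lim.
      + apply (filterlim_Rcpow eventually); [lra | apply INR_ratio_lim].
    - apply kappa_div_wallis_lim. change (0 < Re w + 1). lra. }
  assert (EX : (RtoC (PI / 2) * (RtoC (/ 2) * Rcpow (/ 2) w) * Rcpow 2 (w + 1))%C = RtoC (PI / 2)).
  { rewrite Rcpow_plus, Rcpow_1 by lra.
    transitivity (RtoC (PI / 2) * (RtoC (/ 2) * RtoC 2) * (Rcpow (/ 2) w * Rcpow 2 w))%C; [ring|].
    rewrite <- Rcpow_mult by lra. rewrite <- (RtoC_mult (/ 2) 2). rewrite Rinv_l by lra.
    unfold Rcpow. rewrite ln_1, Cmult_0_r, Cexp_0. ring. }
  rewrite EX in LX.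
  assert (G2 : filterlim (fun n => gauss w (2 * n + 1)) eventually (locally (rGamma w))).
  { apply (filterlim_comp _ _ _ (fun n => (2 * n + 1)%nat) (gauss w) eventually eventually);
      [|apply gauss_cvg].
    intros P [N HN]. exists N. intros n Hn. apply HN. lia. }
  pose proof (filterlim_Cmult eventually _ _ _ _
    (filterlim_Cmult eventually _ _ _ _ (gauss_cvg s) (gauss_cvg (s + RtoC r))) LX) as L1.
  pose proof (filterlim_Cmult eventually _ _ _ _ G2
    (filterlim_const (kappa r (w - 1)))) as L2.
  apply (filterlim_C_unique eventually _ _ _ L1).
  revert L2. apply (filterlim_ext_loc (F := eventually)).
  exists 1%nat. intros n Hn.
  pose proof (Crising_kappa r s n Hw) as E. fold w in E.
  assert (Hn0 : 0 < INR n) by (apply lt_0_INR; lia).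
  assert (Hd0 : 0 < INR (2 * n + 1)) by (apply lt_0_INR; lia).
  unfold X, gauss, wallis. rewrite Rcpow_div by auto.
  set (K := kappa r (w + 1 + RtoC (2 * INR n))) in *.
  assert (F1 : RtoC (INR (fact n)) <> 0) by (apply RtoC_neq_0, INR_fact_neq_0).
  assert (F2 : RtoC (INR (fact (2 * n))) <> 0) by (apply RtoC_neq_0, INR_fact_neq_0).
  assert (N1 : RtoC (INR n) <> 0) by (apply RtoC_neq_0; lra).
  assert (N2 : RtoC (INR (2 * n + 1)) <> 0) by (apply RtoC_neq_0; lra).
  assert (PI0 : RtoC (PI / 2) <> 0) by (apply RtoC_neq_0; lra).
  replace (2 * n + 1)%nat with (S (2 * n)) in * by lia.
  rewrite fact_simpl, mult_INR.
  rewrite !RtoC_mult, !RtoC_div, !RtoC_mult by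
    (try apply Rmult_integral_contrapositive_currified; try apply INR_fact_neq_0; lra).
  (* The exponents satisfy [s + (s + r) = w + 1]: the powers of [n] match up to the single factor
     [n] present in [X n]. *)
  assert (R0 : Rcpow (INR n) (s + RtoC r) = (Rcpow (INR n) w * RtoC (INR n) / Rcpow (INR n) s)%C).
  { rewrite <- (Rcpow_1 (INR n) Hn0).
    rewrite <- Rcpow_plus.
    assert (Rcpow (INR n) s <> 0) by apply Cexp_neq_0.
    replace (w + 1)%C with (s + (s + RtoC r))%C by (unfold w; ring).
    rewrite (Rcpow_plus _ s (s + RtoC r)). field. assumption. }
  assert (C1 : Rcpow (INR n) s <> 0) by apply Cexp_neq_0.
  assert (C2 : Rcpow (INR n) w <> 0) by apply Cexp_neq_0.
  assert (C3 : Rcpow (INR (S (2 * n))) w <> 0) by apply Cexp_neq_0.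
  rewrite R0.
  set (Y := kappa r (w - 1)) in *. set (Z := Crising w (S (2 * n))) in *.
  transitivity (Z * Y / (RtoC (INR (S (2 * n))) * RtoC (INR (fact (2 * n))) *
     Rcpow (INR (S (2 * n))) w))%C; [field; auto|].
  rewrite <- E. field. 
  assert (PI1 : RtoC PI <> 0) by (apply RtoC_neq_0; lra).
  repeat split; auto; apply RtoC_neq_0; lra.
Qed.

(** The hypothesis says exactly [0 < Re (2 s + r - 1)]. The numerator is then away from its poles,
    [psi] takes its raw branch, and one may divide by [rGamma w]. *)
Lemma psi_2_kappa (r : R) (s : C) : (1 - r) / 2 < Re s ->
  psi 2 r s = (RtoC (2 / PI) * kappa r (2 * s + RtoC r - 2))%C.
Proof.
  intros Hs. pose proof PI_RGT_0.
  set (w := (2 * s + RtoC r - 1)%C).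
  assert (Hw : 0 < Re w) by (unfold w; simpl; unfold Re in *; lra).
  assert (A : psi_num_arg 2 r s = w).
  { unfold psi_num_arg, w. ring. }
  unfold psi. rewrite A. destruct excluded_middle_informative as [[n E]|_].
  - exfalso. rewrite E in Hw. simpl in Hw. pose proof (pos_INR n). lra.
  - unfold psi_raw. rewrite A. unfold Gamma.
    replace ((s - 1) * (RtoC 2 - 1) + RtoC r + 1)%C with (s + RtoC r)%C by ring.
    pose proof (kappa_rGamma r s Hw) as E. fold w in E.
    replace (2 * s + RtoC r - 2)%C with (w - 1)%C by (unfold w; ring).
    pose proof (rGamma_neq_0 w Hw) as G0.
    assert (PI1 : RtoC PI <> 0) by (apply RtoC_neq_0; lra).
    transitivity (RtoC (2 / PI) * (rGamma w * kappa r (w - 1)) / rGamma w)%C; [|field; exact G0].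
    rewrite <- E. rewrite !RtoC_div by lra. field. auto.
Qed.

(** * Dirichlet's integral *)

Lemma locally_Rabs (x d : R) (P : R -> Prop) :
  0 < d -> (forall y, Rabs (y - x) < d -> P y) -> locally x P.
Proof. intros Hd H. exists (mkposreal d Hd). exact H. Qed.

(** With [l] the derivative at [c], the continuous extension of the difference quotient. It provides
    both [sinc] and the division by a phase with a simple zero. *)
Definition slope (f : R -> R) (c l y : R) : R :=
  if Req_EM_T y c then l else (f y - f c) / (y - c).

Lemma slope_spec (f : R -> R) (c l y : R) : f y - f c = (y - c) * slope f c l y.
Proof. unfold slope. destruct Req_EM_T as [->|H]; [ring|]. field. lra. Qed.

Lemma slope_continuous (f : R -> R) (c l : R) : is_derive f c l -> continuous (slope f c l) c.
Proof.
  intros H. apply is_derive_Reals in H.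
  apply filterlim_R_iff; [apply locally_filter|]. intros eps He.
  destruct (H eps He) as [d Hd]. apply (locally_Rabs c d); [apply cond_pos|]. intros y Hy.
  unfold slope at 2. destruct (Req_EM_T c c) as [_|]; [|easy].
  unfold slope. destruct (Req_EM_T y c) as [E|E].
  - rewrite Rminus_diag, Rabs_R0. exact He.
  - specialize (Hd (y - c) ltac:(lra) Hy). now replace (c + (y - c)) with y in Hd by ring.
Qed.

Lemma slope_continuous_neq (f : R -> R) (c l y : R) :
  y <> c -> continuous f y -> continuous (slope f c l) y.
Proof.
  intros Hy Hf.
  apply (continuous_ext_loc _ (fun z => (f z - f c) * / (z - c))).
  - assert (Hp : 0 < Rabs (y - c)) by (apply Rabs_pos_lt; lra).
    apply (locally_Rabs y _ _ Hp). intros z Hz.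
    unfold slope. destruct (Req_EM_T z c) as [->|]; [|reflexivity].
    exfalso. rewrite Rabs_minus_sym in Hz. lra.
  - apply (continuous_mult (K := R_AbsRing)).
    + apply (continuous_minus (V := R_NormedModule)); [exact Hf | apply continuous_const].
    + apply continuous_Rinv_comp; [|lra].
      apply (continuous_minus (V := R_NormedModule)); [apply continuous_id | apply continuous_const].
Qed.

Definition sinc : R -> R := slope sin 0 1.

Lemma sinc_spec (y : R) : y * sinc y = sin y.
Proof. pose proof (slope_spec sin 0 1 y) as H. rewrite sin_0, !Rminus_0_r in H. now symmetry. Qed.

Lemma sinc_0 : sinc 0 = 1.
Proof. unfold sinc, slope. now destruct (Req_EM_T 0 0). Qed.

Lemma sinc_continuous (y : R) : continuous sinc y.
Proof.
  destruct (Req_dec y 0) as [->|H].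
  - apply slope_continuous. rewrite <- cos_0. apply is_derive_sin.
  - apply slope_continuous_neq; [exact H|].
    apply (ex_derive_continuous (V := R_NormedModule)). eexists. apply is_derive_sin.
Qed.

Lemma sinc_opp (y : R) : sinc (- y) = sinc y.
Proof.
  destruct (Req_dec y 0) as [->|H]; [now rewrite Ropp_0|].
  apply Rmult_eq_reg_l with (- y); [|lra].
  rewrite sinc_spec, sin_neg, <- Ropp_mult_distr_l, sinc_spec. reflexivity.
Qed.

Lemma sinc_ex_RInt (a b : R) : ex_RInt sinc a b.
Proof.
  apply (ex_RInt_continuous (V := R_CompleteNormedModule)). intros; apply sinc_continuous.
Qed.

Definition Si (y : R) : R := RInt sinc 0 y.

Lemma is_derive_Si (y : R) : is_derive Si y (sinc y).
Proof.
  apply (is_derive_RInt (V := R_NormedModule) sinc Si 0 y); [|apply sinc_continuous].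
  apply filter_forall. intros z.
  apply (RInt_correct (V := R_CompleteNormedModule)), sinc_ex_RInt.
Qed.

Lemma Si_opp (y : R) : Si (- y) = - Si y.
Proof.
  unfold Si. apply is_RInt_unique.
  pose proof (is_RInt_comp_opp (V := R_NormedModule) sinc 0 (- y) (RInt sinc 0 y)) as H.
  rewrite Ropp_0, Ropp_involutive in H.
  specialize (H (RInt_correct (V := R_CompleteNormedModule) _ _ _ (sinc_ex_RInt 0 y))).
  apply (is_RInt_opp (V := R_NormedModule)) in H.
  apply (is_RInt_ext _ sinc) in H; [exact H|].
  intros z _. unfold opp; simpl. rewrite sinc_opp. ring.
Qed.

(* Integration by parts in [int (q u') sin (T u)], with [u'] cancelled by the phase. *)
Lemma riemann_lebesgue (q dq u du : R -> R) (a b : R) : a <= b ->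
  (forall x, a <= x <= b -> is_derive q x (dq x) /\ continuous dq x) ->
  (forall x, a <= x <= b -> is_derive u x (du x) /\ continuous du x) ->
  filterlim (fun T => RInt (fun x => q x * du x * sin (T * u x)) a b)
    (Rbar_locally p_infty) (locally 0).
Proof.
  intros Hab Hq Hu.
  assert (Cdq : ex_RInt (fun x => Rabs (dq x)) a b).
  { apply (ex_RInt_continuous (V := R_CompleteNormedModule)). intros z Hz.
    rewrite Rmin_left, Rmax_right in Hz by auto.
    apply continuous_comp; [now apply Hq | apply continuous_Rabs]. }
  set (K := Rabs (q a) + Rabs (q b) + RInt (fun x => Rabs (dq x)) a b).
  assert (B : forall T, 0 < T ->
    Rabs (RInt (fun x => q x * du x * sin (T * u x)) a b) <= K / T).
  { intros T HT.
    assert (Cu : forall x, a <= x <= b -> continuous (fun x => T * u x) x).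
    { intros x Hx. apply (continuous_scal_r (V := R_NormedModule)).
      apply (ex_derive_continuous (V := R_NormedModule)). eexists. now apply Hu. }
    assert (Csin : forall x, a <= x <= b -> continuous (fun x => sin (T * u x)) x).
    { intros x Hx. apply (continuous_comp (fun x => T * u x) sin); [now apply Cu|].
      apply continuous_sin. }
    assert (Ccos : forall x, a <= x <= b -> continuous (fun x => cos (T * u x)) x).
    { intros x Hx. apply (continuous_comp (fun x => T * u x) cos); [now apply Cu|].
      apply continuous_cos. }
    assert (E1 : ex_RInt (fun x => dq x * cos (T * u x)) a b).
    { apply (ex_RInt_continuous (V := R_CompleteNormedModule)). intros z Hz.
      rewrite Rmin_left, Rmax_right in Hz by auto.
      apply (continuous_mult (K := R_AbsRing)); [now apply Hq | now apply Ccos]. }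
    assert (D : is_RInt (fun x => q x * du x * sin (T * u x) - / T * (dq x * cos (T * u x))) a b
      (- / T * (q b * cos (T * u b)) - - / T * (q a * cos (T * u a)))).
    { apply (is_RInt_derive (V := R_CompleteNormedModule) (fun x => - / T * (q x * cos (T * u x)))).
      - intros x Hx. rewrite Rmin_left, Rmax_right in Hx by auto.
        destruct (Hq x Hx) as [Dq _]. destruct (Hu x Hx) as [Du _].
        replace (q x * du x * sin (T * u x) - / T * (dq x * cos (T * u x))) with
          (- / T * (dq x * cos (T * u x) + q x * (T * du x * - sin (T * u x)))) by (field; lra).
        apply (is_derive_scal (fun x => q x * cos (T * u x))).
        apply (is_derive_Rmult q (fun x => cos (T * u x))); [exact Dq|].
        apply (is_derive_comp cos (fun x => T * u x)); [apply is_derive_cos|].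
        now apply is_derive_scal.
      - intros x Hx. rewrite Rmin_left, Rmax_right in Hx by auto.
        apply (continuous_minus (V := R_NormedModule)).
        + apply (continuous_mult (K := R_AbsRing)); [|now apply Csin].
          apply (continuous_mult (K := R_AbsRing)); [|now apply Hu].
          apply (ex_derive_continuous (V := R_NormedModule)). eexists. now apply Hq.
        + apply (continuous_scal_r (V := R_NormedModule)).
          apply (continuous_mult (K := R_AbsRing)); [now apply Hq | now apply Ccos]. }
    pose proof (is_RInt_plus (V := R_NormedModule) _ _ _ _ _ _ D
      (is_RInt_scal (V := R_NormedModule) _ _ _ (/ T) _
        (RInt_correct (V := R_CompleteNormedModule) _ _ _ E1))) as D2.
    apply (is_RInt_ext _ (fun x => q x * du x * sin (T * u x))) in D2.
    2: { intros x _. unfold plus, scal; simpl. unfold mult; simpl. ring. }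
    rewrite (is_RInt_unique _ _ _ _ D2).
    assert (I1 : Rabs (RInt (fun x => dq x * cos (T * u x)) a b) <= RInt (fun x => Rabs (dq x)) a b).
    { apply (norm_RInt_le (V := R_NormedModule) (fun x => dq x * cos (T * u x))
        (fun x => Rabs (dq x)) a b _ _ Hab).
      - intros x _. unfold norm; simpl. unfold abs; simpl. rewrite Rabs_mult.
        assert (Rabs (cos (T * u x)) <= 1) by (apply Rabs_le, COS_bound).
        pose proof (Rabs_pos (dq x)). nra.
      - apply (RInt_correct (V := R_CompleteNormedModule)), E1.
      - apply (RInt_correct (V := R_CompleteNormedModule)), Cdq. }
    set (I0 := RInt (fun x => dq x * cos (T * u x)) a b) in *.
    assert (HT' : 0 < / T) by (now apply Rinv_0_lt_compat).
    unfold plus, scal; simpl. unfold mult; simpl.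
    replace (- / T * (q b * cos (T * u b)) - - / T * (q a * cos (T * u a)) + / T * I0)
      with ((- (q b * cos (T * u b)) + (q a * cos (T * u a)) + I0) * / T) by ring.
    rewrite Rabs_mult, (Rabs_right (/ T)) by lra.
    apply Rmult_le_compat_r; [lra|].
    eapply Rle_trans; [apply Rabs_triang|].
    eapply Rle_trans; [apply Rplus_le_compat_r, Rabs_triang|].
    rewrite Rabs_Ropp, !Rabs_mult. unfold K.
    assert (Rabs (cos (T * u a)) <= 1) by (apply Rabs_le, COS_bound).
    assert (Rabs (cos (T * u b)) <= 1) by (apply Rabs_le, COS_bound).
    pose proof (Rabs_pos (q a)). pose proof (Rabs_pos (q b)). nra. }
  assert (HK : 0 <= K).
  { unfold K. pose proof (Rabs_pos (q a)). pose proof (Rabs_pos (q b)).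
    assert (0 <= RInt (fun x => Rabs (dq x)) a b)
      by (apply RInt_ge_0; [auto | auto | intros; apply Rabs_pos]). lra. }
  apply (filterlim_R_iff (Rbar_locally p_infty)). intros eps He.
  exists (K / eps + 1). intros T HT.
  assert (0 <= K / eps) by (apply Rmult_le_pos; [auto | left; now apply Rinv_0_lt_compat]).
  rewrite Rminus_0_r. eapply Rle_lt_trans; [apply B; lra|].
  apply Rmult_lt_reg_r with T; [lra|]. unfold Rdiv. rewrite Rmult_assoc, Rinv_l, Rmult_1_r by lra.
  replace K with (K / eps * eps) at 1 by (field; lra). rewrite (Rmult_comm eps).
  apply Rmult_lt_compat_r; lra.
Qed.

(** Under a bound uniform in [i], end pieces of length [d] cost at most [d] times that bound. This
    lets Riemann-Lebesgue be used with amplitudes that are smooth only inside the interval. *)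
Lemma RInt_lim_0_of_interior {I : Type} (F : (I -> Prop) -> Prop) {FF : Filter F}
  (f : I -> R -> R) (M a b : R) : a < b ->
  (forall i x, a <= x <= b -> continuous (f i) x) ->
  (forall i x, a <= x <= b -> Rabs (f i x) <= M) ->
  (forall a' b', a < a' <= b' -> b' < b ->
     filterlim (fun i => RInt (f i) a' b') F (locally 0)) ->
  filterlim (fun i => RInt (f i) a b) F (locally 0).
Proof.
  intros Hab Hc HM H. apply (filterlim_R_iff F). intros eps He.
  set (M1 := Rabs M + 1). assert (HM1 : 0 < M1) by (unfold M1; pose proof (Rabs_pos M); lra).
  set (d := Rmin ((b - a) / 3) (eps / (4 * M1))).
  assert (Hd : 0 < d <= (b - a) / 3 /\ d * M1 <= eps / 4).
  { unfold d. assert (0 < eps / (4 * M1)) by (apply Rdiv_lt_0_compat; lra).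
    pose proof (Rmin_l ((b - a) / 3) (eps / (4 * M1))).
    pose proof (Rmin_r ((b - a) / 3) (eps / (4 * M1))).
    split; [split; [apply Rmin_glb_lt; lra | auto]|].
    apply Rle_trans with (eps / (4 * M1) * M1); [apply Rmult_le_compat_r; lra|].
    right. field. lra. }
  destruct Hd as [[Hd0 Hd1] Hd2].
  generalize (proj1 (filterlim_R_iff F _ _) (H (a + d) (b - d) ltac:(lra) ltac:(lra))
    (eps / 2) ltac:(lra)).
  apply filter_imp. intros i Hi. rewrite Rminus_0_r in *.
  assert (Ex : forall c e, a <= c -> c <= e -> e <= b -> ex_RInt (f i) c e).
  { intros c e H1 H2 H3. apply (ex_RInt_continuous (V := R_CompleteNormedModule)). intros z Hz.
    rewrite Rmin_left, Rmax_right in Hz by auto. apply Hc. lra. }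
  assert (Bd : forall c e, a <= c -> c <= e -> e <= b -> Rabs (RInt (f i) c e) <= (e - c) * M1).
  { intros c e H1 H2 H3. apply abs_RInt_le_const; auto.
    intros t Ht. eapply Rle_trans; [apply HM; lra|]. unfold M1. pose proof (Rle_abs M). lra. }
  rewrite <- (RInt_Chasles (V := R_CompleteNormedModule) (f i) a (a + d) b) by (apply Ex; lra).
  rewrite <- (RInt_Chasles (V := R_CompleteNormedModule) (f i) (a + d) (b - d) b) by (apply Ex; lra).
  unfold plus; simpl.
  eapply Rle_lt_trans; [apply Rabs_triang|].
  eapply Rle_lt_trans; [apply Rplus_le_compat_l, Rabs_triang|].
  pose proof (Bd a (a + d) ltac:(lra) ltac:(lra) ltac:(lra)).
  pose proof (Bd (b - d) b ltac:(lra) ltac:(lra) ltac:(lra)).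
  replace (a + d - a) with d in * by ring. replace (b - (b - d)) with d in * by ring. lra.
Qed.

(** The Dirichlet kernel [sin ((2 n + 1) x) / sin x], written as a cosine sum: it is then continuous
    at [0], and only its constant term contributes to the integral over [[0, PI / 2]]. *)
Fixpoint dirichlet (n : nat) (x : R) : R :=
  match n with
  | O => 1
  | S m => dirichlet m x + 2 * cos (2 * INR n * x)
  end.

Lemma dirichlet_sin (n : nat) (x : R) : dirichlet n x * sin x = sin ((2 * INR n + 1) * x).
Proof.
  induction n as [|n IH].
  - simpl. rewrite Rmult_0_r, Rplus_0_l, !Rmult_1_l. reflexivity.
  - cbn [dirichlet]. rewrite Rmult_plus_distr_r, IH, S_INR.
    replace ((2 * INR n + 1) * x) with (2 * (INR n + 1) * x - x) by ring.
    replace ((2 * (INR n + 1) + 1) * x) with (2 * (INR n + 1) * x + x) by ring.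
    rewrite sin_minus, sin_plus. ring.
Qed.

Lemma is_RInt_dirichlet (n : nat) : is_RInt (dirichlet n) 0 (PI / 2) (PI / 2).
Proof.
  induction n as [|n IH].
  - assert (K : is_RInt (fun _ => 1) 0 (PI / 2) ((PI / 2 - 0) * 1))
      by exact (is_RInt_const (V := R_NormedModule) 0 (PI / 2) 1).
    now rewrite Rminus_0_r, Rmult_1_r in K.
  - set (k := INR (S n)). assert (Hk : 0 < k) by (apply lt_0_INR; lia).
    assert (S0 : sin (2 * k * (PI / 2)) = 0).
    { replace (2 * k * (PI / 2)) with (INR (S n) * PI) by (unfold k; field).
      apply sin_eq_0_1. exists (Z.of_nat (S n)). now rewrite <- INR_IZR_INZ. }
    assert (D : is_RInt (fun x => 2 * cos (2 * k * x)) 0 (PI / 2)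
      (sin (2 * k * (PI / 2)) / k - sin (2 * k * 0) / k)).
    { apply (is_RInt_derive (V := R_CompleteNormedModule) (fun x => sin (2 * k * x) / k)).
      - intros x _. auto_derive; [exact I | field; lra].
      - intros x _. apply (ex_derive_continuous (V := R_NormedModule)). auto_derive. exact I. }
    rewrite S0, Rmult_0_r, sin_0 in D.
    pose proof (is_RInt_plus (V := R_NormedModule) _ _ _ _ _ _ IH D) as E.
    unfold plus in E; simpl in E.
    replace (PI / 2 + (0 / k - 0 / k)) with (PI / 2) in E by (field; lra). exact E.
Qed.

Lemma dirichlet_continuous (n : nat) (x : R) : continuous (dirichlet n) x.
Proof.
  induction n as [|n IH]; [apply continuous_const|].
  apply (continuous_plus (V := R_NormedModule)); [exact IH|].
  apply (ex_derive_continuous (V := R_NormedModule)). auto_derive. exact I.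
Qed.

Lemma sinc_scaled_continuous (a x : R) : continuous (fun x => a * sinc (a * x)) x.
Proof.
  apply (continuous_scal_r (V := R_NormedModule)).
  apply (continuous_comp (fun x => a * x) sinc); [|apply sinc_continuous].
  apply (continuous_scal_r (V := R_NormedModule)), continuous_id.
Qed.

(** Here [x^2 <= 4], so the cubic bound gives both [x - sin x <= x^3 / 6] and [x / 3 <= sin x]; the
    difference is at most [x / 2 <= 1]. *)
Lemma cosec_sub_inv_bound (x : R) : 0 < x <= PI / 2 -> Rabs (/ sin x - / x) <= 1.
Proof.
  intros Hx. pose proof PI_4. pose proof (sin_lt_x x ltac:(lra)) as H1.
  pose proof (sin_ge_cubic x ltac:(lra)) as H2.
  assert (Hs : 0 < sin x) by (apply sin_gt_0; lra).
  assert (H3 : x / 3 <= sin x) by (simpl in H2; nra).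
  replace (/ sin x - / x) with ((x - sin x) / (x * sin x)) by (field; lra).
  rewrite Rabs_right.
  2: { apply Rle_ge, Rmult_le_pos; [lra|]. left; apply Rinv_0_lt_compat. nra. }
  apply Rmult_le_reg_r with (x * sin x); [nra|].
  unfold Rdiv. rewrite Rmult_assoc, Rinv_l by nra.
  simpl in H2. nra.
Qed.

(** By rescaling, this [Si] is the integral of [sin ((2 n + 1) x) / x] over [[0, PI / 2]]. Replacing
    [1 / x] by [1 / sin x] gives the Dirichlet kernel, with integral [PI / 2]; the difference has a
    bounded amplitude and tends to [0] by Riemann-Lebesgue. *)
Lemma Si_odd_multiples_lim :
  filterlim (fun n : nat => Si ((2 * INR n + 1) * (PI / 2))) eventually (locally (PI / 2)).
Proof.
  pose proof PI_RGT_0. pose proof PI_4.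
  set (f := fun (n : nat) x => dirichlet n x - (2 * INR n + 1) * sinc ((2 * INR n + 1) * x)).
  assert (E : forall n x, 0 < x <= PI / 2 -> f n x = (/ sin x - / x) * sin ((2 * INR n + 1) * x)).
  { intros n x Hx. unfold f. rewrite Rmult_minus_distr_r.
    assert (0 < sin x) by (apply sin_gt_0; lra).
    rewrite <- (dirichlet_sin n x) at 1. rewrite <- (sinc_spec ((2 * INR n + 1) * x)).
    field. lra. }
  assert (C : forall n x, continuous (f n) x).
  { intros n x. apply (continuous_minus (V := R_NormedModule));
      [apply dirichlet_continuous | apply sinc_scaled_continuous]. }
  assert (F0 : forall n, f n 0 = 0).
  { intros n. unfold f. rewrite Rmult_0_r, sinc_0.
    induction n as [|n IH]; [simpl; ring|].
    cbn [dirichlet]. rewrite S_INR, Rmult_0_r, cos_0. lra. }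
  assert (L : filterlim (fun n => RInt (f n) 0 (PI / 2)) eventually (locally 0)).
  { apply (RInt_lim_0_of_interior eventually f 1); [lra | auto | |].
    - intros n x Hx. destruct (Req_dec x 0) as [->|].
      + rewrite F0, Rabs_R0. lra.
      + rewrite E by lra. rewrite Rabs_mult.
        pose proof (cosec_sub_inv_bound x ltac:(lra)).
        assert (Rabs (sin ((2 * INR n + 1) * x)) <= 1) by (apply Rabs_le, SIN_bound).
        pose proof (Rabs_pos (/ sin x - / x)). pose proof (Rabs_pos (sin ((2 * INR n + 1) * x))).
        nra.
    - intros a b Ha Hb.
      apply (filterlim_ext (fun n : nat => (fun T => RInt (fun x =>
        (/ sin x - / x) * 1 * sin (T * x)) a b) (2 * INR n + 1))).
      { intros n. apply (RInt_ext (V := R_CompleteNormedModule)). intros x Hx.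
        rewrite Rmin_left, Rmax_right in Hx by lra.
        match goal with |- ?a = ?b => change (@eq R a b) end. rewrite E by lra. ring. }
      apply (filterlim_comp _ _ _ (fun n : nat => 2 * INR n + 1) (fun T => RInt (fun x =>
        (/ sin x - / x) * 1 * sin (T * x)) a b) eventually (Rbar_locally p_infty));
        [|apply (riemann_lebesgue (fun x => / sin x - / x)
        (fun x => - cos x / sin x ^ 2 + / x ^ 2) (fun x => x) (fun _ => 1)); [lra | |]].
      + intros P [M HM]. destruct (INR_unbounded M) as [N HN].
        exists N. intros n Hn. apply HM. apply le_INR in Hn. pose proof (pos_INR n). lra.
      + intros x Hx. assert (0 < sin x) by (apply sin_gt_0; lra). split.
        * auto_derive; [repeat split; lra | field; lra].
        * apply (ex_derive_continuous (V := R_NormedModule)). auto_derive.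
          repeat split; try lra; nra.
      + intros x _. split; [apply (is_derive_id (K := R_AbsRing)) | apply continuous_const]. }
  apply (filterlim_ext (fun n => PI / 2 + - RInt (f n) 0 (PI / 2))).
  - intros n.
    assert (D : is_RInt (fun x => (2 * INR n + 1) * sinc ((2 * INR n + 1) * x)) 0 (PI / 2)
       (Si ((2 * INR n + 1) * (PI / 2)) - Si ((2 * INR n + 1) * 0))).
    { apply (is_RInt_derive (V := R_CompleteNormedModule) (fun x => Si ((2 * INR n + 1) * x))).
      - intros x _. apply (is_derive_comp Si (fun x => (2 * INR n + 1) * x)).
        + apply is_derive_Si.
        + auto_derive; [exact I | ring].
      - intros x _. apply sinc_scaled_continuous. }
    unfold Si at 2 in D. rewrite Rmult_0_r, RInt_point in D. unfold zero in D; simpl in D.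
    pose proof (is_RInt_minus (V := R_NormedModule) _ _ _ _ _ _ (is_RInt_dirichlet n) D) as M.
    assert (M' : RInt (f n) 0 (PI / 2) = PI / 2 - (Si ((2 * INR n + 1) * (PI / 2)) - 0))
      by exact (is_RInt_unique _ _ _ _ M).
    rewrite M'. ring.
  - replace (locally (PI / 2)) with (locally (PI / 2 + - 0)) by (f_equal; ring).
    apply (filterlim_Rplus eventually); [apply filterlim_const|].
    now apply (filterlim_Ropp eventually).
Qed.

(** Integrating [sin x / x] by parts gives boundary terms at most [1 / z + 1 / y] and a remainder at
    most [1 / z - 1 / y]. *)
Lemma Si_oscillation_le (z y : R) : 0 < z <= y -> Rabs (Si y - Si z) <= 2 / z.
Proof.
  intros H.
  assert (P : forall x, Rmin z y <= x <= Rmax z y -> 0 < x).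
  { intros x Hx. rewrite Rmin_left, Rmax_right in Hx by lra. lra. }
  assert (D : is_RInt (fun x => sinc x + cos x / x ^ 2) z y (- (cos y / y) - - (cos z / z))).
  { apply (is_RInt_derive (V := R_CompleteNormedModule) (fun x => - (cos x / x))).
    - intros x Hx. specialize (P x Hx). auto_derive; [lra|].
      pose proof (sinc_spec x) as S. apply Rmult_eq_reg_l with x; [|lra].
      rewrite (Rmult_plus_distr_l x (sinc x)), S. field. lra.
    - intros x Hx. specialize (P x Hx). apply (continuous_plus (V := R_NormedModule)).
      + apply sinc_continuous.
      + apply (ex_derive_continuous (V := R_NormedModule)). auto_derive. apply (pow_nonzero x 2). lra. }
  assert (D' : is_RInt sinc z y (Si y - Si z)).
  { apply (is_RInt_derive (V := R_CompleteNormedModule) Si);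
      intros; [apply is_derive_Si | apply sinc_continuous]. }
  assert (D2 : is_RInt (fun x => / x ^ 2) z y (- / y - - / z)).
  { apply (is_RInt_derive (V := R_CompleteNormedModule) (fun x => - / x)).
    - intros x Hx. specialize (P x Hx). auto_derive; [lra | field; lra].
    - intros x Hx. specialize (P x Hx).
      apply (ex_derive_continuous (V := R_NormedModule)). auto_derive. apply (pow_nonzero x 2). lra. }
  pose proof (is_RInt_minus (V := R_NormedModule) _ _ _ _ _ _ D D') as M.
  assert (B : Rabs (- (cos y / y) - - (cos z / z) - (Si y - Si z)) <= - / y - - / z).
  { apply (norm_RInt_le (V := R_NormedModule)) with
      (1 := proj2 H) (3 := M) (4 := D2).
    intros x Hx. unfold norm, minus, plus, opp; simpl. unfold abs; simpl.
    assert (0 < / (x * (x * 1))) by (apply Rinv_0_lt_compat; nra).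
    replace (sinc x + cos x / (x * (x * 1)) + - sinc x) with (cos x * / (x * (x * 1)))
      by (unfold Rdiv; ring).
    rewrite Rabs_mult, (Rabs_right (/ _)) by lra.
    assert (Rabs (cos x) <= 1) by (apply Rabs_le, COS_bound). nra. }
  assert (0 < / z) by (apply Rinv_0_lt_compat; lra).
  assert (0 < / y) by (apply Rinv_0_lt_compat; lra).
  assert (Cy : Rabs (cos y / y) <= / y).
  { unfold Rdiv. rewrite Rabs_mult, (Rabs_right (/ y)) by lra.
    assert (Rabs (cos y) <= 1) by (apply Rabs_le, COS_bound). nra. }
  assert (Cz : Rabs (cos z / z) <= / z).
  { unfold Rdiv. rewrite Rabs_mult, (Rabs_right (/ z)) by lra.
    assert (Rabs (cos z) <= 1) by (apply Rabs_le, COS_bound). nra. }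
  apply Rabs_le_between in B. apply Rabs_le_between in Cy. apply Rabs_le_between in Cz.
  apply Rabs_le. unfold Rdiv at 1 2. lra.
Qed.

(** The oscillation bound carries the limit from odd multiples of [PI / 2] to all arguments;
    [z > 4 / eps] makes the oscillation beyond [z] less than [eps / 2]. *)
Lemma Si_lim : filterlim Si (Rbar_locally p_infty) (locally (PI / 2)).
Proof.
  pose proof PI_RGT_0. apply (filterlim_R_iff (Rbar_locally p_infty)). intros eps He.
  destruct (proj1 (filterlim_R_iff eventually _ _) Si_odd_multiples_lim (eps / 2) ltac:(lra))
    as [N HN].
  destruct (INR_unbounded (4 / eps)) as [N' HN'].
  set (n := Nat.max N N'). specialize (HN n ltac:(lia)).
  assert (INR N' <= INR n) by (apply le_INR; lia).
  assert (0 < 4 / eps) by (apply Rdiv_lt_0_compat; lra).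
  set (z := (2 * INR n + 1) * (PI / 2)) in *.
  assert (Hz : 4 / eps < z).
  { unfold z. pose proof PI2_3_2. nra. }
  exists z. intros y Hy.
  replace (Si y - PI / 2) with ((Si y - Si z) + (Si z - PI / 2)) by ring.
  eapply Rle_lt_trans; [apply Rabs_triang|].
  pose proof (Si_oscillation_le z y ltac:(lra)).
  assert (2 / z < eps / 2); [|lra].
  apply Rmult_lt_reg_r with z; [lra|]. unfold Rdiv at 1. rewrite Rmult_assoc, Rinv_l by lra.
  apply Rmult_lt_reg_l with (2 / eps); [apply Rdiv_lt_0_compat; lra|].
  replace (2 / eps * (eps / 2 * z)) with z by (field; lra). lra.
Qed.

(** * Fourier inversion across the zero of the phase *)

(** The derivative is allowed to vanish at the left end, as that of the phase does at [0]; the mean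
    value point is interior and never meets it. *)
Lemma strictly_decreasing_of_derive (u du : R -> R) (a b : R) :
  (forall t, a <= t <= b -> is_derive u t (du t)) ->
  (forall t, a < t <= b -> du t < 0) ->
  forall s t, a <= s -> s < t -> t <= b -> u t < u s.
Proof.
  intros Hu Hdu s t Hs Hst Ht.
  destruct (MVT_cor2 u du s t Hst) as [c [E Hc]].
  - intros c Hc. apply is_derive_Reals, Hu. lra.
  - specialize (Hdu c ltac:(lra)). nra.
Qed.

Ltac solve_continuous :=
  lazymatch goal with
  | |- continuous (fun t => @?f t + @?g t) _ =>
      apply (continuous_plus (V := R_NormedModule) f g); solve_continuous
  | |- continuous (fun t => @?f t - @?g t) _ =>
      apply (continuous_minus (V := R_NormedModule) f g); solve_continuous
  | |- continuous (fun t => @?f t * @?g t) _ =>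
      apply (continuous_mult (K := R_AbsRing) f g); solve_continuous
  | |- continuous (fun t => / @?f t) _ =>
      apply (continuous_Rinv_comp f); [solve_continuous | auto]
  | |- continuous (fun _ => ?k) _ => first [apply continuous_const | assumption]
  | |- _ => assumption
  end.

(** Since [u] has a simple zero at [c] where [N] vanishes too, [N / u] is the quotient of the two
    slopes, which is continuous on the compact interval. *)
Lemma quotient_bounded (N dN u du : R -> R) (b c : R) : 0 < c < b ->
  (forall t, 0 <= t <= b -> is_derive N t (dN t)) ->
  (forall t, 0 <= t <= b -> is_derive u t (du t)) ->
  (forall t, 0 <= t <= b -> t <> c -> u t <> 0) ->
  N c = 0 -> u c = 0 -> du c <> 0 ->
  exists M, forall t, 0 <= t <= b -> Rabs (N t) <= M * Rabs (u t).
Proof.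
  intros Hc HN Hu Hu0 Nc uc Hdu.
  set (g := fun t => slope N c (dN c) t * / slope u c (du c) t).
  assert (Cs : forall f df, (forall t, 0 <= t <= b -> is_derive f t (df t)) ->
    forall t, 0 <= t <= b -> continuous (slope f c (df c)) t).
  { intros f df Hf t Ht. destruct (Req_dec t c) as [->|Htc].
    - apply slope_continuous, Hf. lra.
    - apply slope_continuous_neq; [exact Htc|].
      apply (ex_derive_continuous (V := R_NormedModule)). eexists. apply Hf; lra. }
  assert (U0 : forall t, 0 <= t <= b -> slope u c (du c) t <> 0).
  { intros t Ht E. destruct (Req_dec t c) as [->|Htc].
    - unfold slope in E. destruct (Req_EM_T c c); congruence.
    - apply (Hu0 t Ht Htc). pose proof (slope_spec u c (du c) t) as S. rewrite E, uc in S. lra. }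
  destruct (continuity_ab_maj (fun t => Rabs (g t)) 0 b ltac:(lra)) as [m [Hm _]].
  { intros t Ht. apply continuity_pt_filterlim.
    apply (continuous_comp g Rabs); [|apply continuous_Rabs].
    apply (continuous_mult (K := R_AbsRing)); [now apply Cs|].
    apply continuous_Rinv_comp; [now apply Cs | now apply U0]. }
  exists (Rabs (g m)). intros t Ht.
  assert (E : N t = g t * u t).
  { pose proof (slope_spec N c (dN c) t) as SN. pose proof (slope_spec u c (du c) t) as Su.
    rewrite Nc, Rminus_0_r in SN. rewrite uc, Rminus_0_r in Su.
    rewrite SN, Su. unfold g. field. now apply U0. }
  rewrite E, Rabs_mult. apply Rmult_le_compat_r; [apply Rabs_pos | now apply Hm].
Qed.

(* Subtracting the multiple of [du] that agrees with [h] at [c] leaves an amplitude vanishing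
   with [u], to which Riemann-Lebesgue applies; the [du] part integrates exactly to [Si]. *)
Lemma fourier_inversion (h dh u du ddu : R -> R) (b c : R) : 0 < c < b ->
  (forall t, 0 <= t <= b -> is_derive h t (dh t) /\ continuous dh t) ->
  (forall t, 0 <= t <= b -> is_derive u t (du t)) ->
  (forall t, 0 <= t <= b -> is_derive du t (ddu t) /\ continuous ddu t) ->
  (forall t, 0 < t <= b -> du t < 0) ->
  u c = 0 ->
  filterlim (fun T => RInt (fun t => h t * (T * sinc (T * u t))) 0 b)
    (Rbar_locally p_infty) (locally (PI * (h c / - du c))).
Proof.
  intros Hc Hh Hu Hdu Hneg uc.
  set (H := h c / - du c).
  set (N := fun t => h t + H * du t). set (dN := fun t => dh t + H * ddu t).
  pose proof (Hneg c ltac:(lra)) as Hdc.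
  pose proof (strictly_decreasing_of_derive u du 0 b Hu Hneg) as Mono.
  assert (Upos : forall t, 0 <= t < c -> 0 < u t) by (intros; rewrite <- uc; apply Mono; lra).
  assert (Uneg : forall t, c < t <= b -> u t < 0) by (intros; rewrite <- uc; apply Mono; lra).
  assert (HN : forall t, 0 <= t <= b -> is_derive N t (dN t)).
  { intros t Ht. apply (is_derive_plus (V := R_NormedModule) h (fun t => H * du t)).
    - now apply Hh.
    - apply is_derive_scal. now apply Hdu. }
  assert (Nc : N c = 0) by (unfold N, H; field; lra).
  assert (Cd : forall (f : R -> R) (l t : R), is_derive f t l -> continuous f t).
  { intros f l t Hf. apply (ex_derive_continuous (V := R_NormedModule)). now exists l. }
  assert (CN : forall t, 0 <= t <= b -> continuous N t) by (intros; eapply Cd, HN; auto).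
  assert (Cu : forall t, 0 <= t <= b -> continuous u t) by (intros; eapply Cd, Hu; auto).
  assert (Cdu : forall t, 0 <= t <= b -> continuous du t) by (intros; eapply Cd, Hdu; auto).
  assert (Csinc : forall T t, 0 <= t <= b -> continuous (fun t => T * sinc (T * u t)) t).
  { intros T t Ht. apply (continuous_scal_r (V := R_NormedModule)).
    apply (continuous_comp (fun t => T * u t) sinc); [|apply sinc_continuous].
    apply (continuous_scal_r (V := R_NormedModule)). now apply Cu. }
  assert (CNs : forall T t, 0 <= t <= b -> continuous (fun t => N t * (T * sinc (T * u t))) t).
  { intros T t Ht. apply (continuous_mult (K := R_AbsRing)); [now apply CN | now apply Csinc]. }
  destruct (quotient_bounded N dN u du b c Hc HN Hu) as [M HM]; auto.
  { intros t Ht Htc. destruct (Rlt_dec t c).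
    - pose proof (Upos t ltac:(lra)). lra.
    - pose proof (Uneg t ltac:(lra)). lra. }
  { lra. }
  (* Away from the zero of [u], [T * sinc (T * u)] is [sin (T * u) / u], so the product is at most
     [|N| / |u|]; at the zero [N] vanishes as well. The bound does not involve [T]. *)
  assert (Bd : forall T t, 0 <= t <= b -> Rabs (N t * (T * sinc (T * u t))) <= Rabs M).
  { intros T t Ht. destruct (Req_dec (u t) 0) as [E|E].
    - assert (N t = 0) as ->.
      { specialize (HM t Ht). rewrite E, Rabs_R0, Rmult_0_r in HM.
        pose proof (Rabs_pos (N t)). apply Rabs_eq_0. lra. }
      rewrite Rmult_0_l, Rabs_R0. apply Rabs_pos.
    - assert (Hp : 0 < Rabs (u t)) by (now apply Rabs_pos_lt).
      apply Rmult_le_reg_r with (Rabs (u t)); [exact Hp|].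
      rewrite <- Rabs_mult.
      replace (N t * (T * sinc (T * u t)) * u t) with (N t * (T * u t * sinc (T * u t))) by ring.
      rewrite sinc_spec, Rabs_mult.
      assert (Rabs (sin (T * u t)) <= 1) by (apply Rabs_le, SIN_bound).
      specialize (HM t Ht). pose proof (Rle_abs M). pose proof (Rabs_pos (N t)).
      pose proof (Rabs_pos (sin (T * u t))).
      apply Rle_trans with (Rabs (N t)); [nra|]. nra. }
  (* The amplitude handed to Riemann-Lebesgue is [N / (u du)], which is singular at [c] and possibly
     at [0]. The subintervals avoid both points. *)
  assert (RL : forall a' b', 0 < a' <= b' -> b' <= b -> (b' < c \/ c < a') ->
    filterlim (fun T => RInt (fun t => N t * (T * sinc (T * u t))) a' b')
      (Rbar_locally p_infty) (locally 0)).
  { intros a' b' Ha Hb Hside.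
    assert (U0 : forall t, a' <= t <= b' -> u t <> 0).
    { intros t Ht. destruct Hside.
      - pose proof (Upos t ltac:(lra)). lra.
      - pose proof (Uneg t ltac:(lra)). lra. }
    assert (D0 : forall t, a' <= t <= b' -> du t <> 0).
    { intros t Ht. pose proof (Hneg t ltac:(lra)). lra. }
    apply (filterlim_ext (fun T => RInt (fun t => N t * / (u t * du t) * du t * sin (T * u t)) a' b')).
    { intros T. apply (RInt_ext (V := R_CompleteNormedModule)). intros t Ht.
      rewrite Rmin_left, Rmax_right in Ht by lra.
      match goal with |- ?a = ?b => change (@eq R a b) end.
      rewrite <- sinc_spec. field. split; [apply D0; lra | apply U0; lra]. }
    apply (riemann_lebesgue (fun t => N t * / (u t * du t))
      (fun t => dN t * / (u t * du t)
        - N t * ((du t * du t + u t * ddu t) * / ((u t * du t) * (u t * du t)))) u du); [lra| |].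
    - intros t Ht. assert (Ht' : 0 <= t <= b) by lra.
      specialize (U0 t Ht). specialize (D0 t Ht).
      assert (UD : u t * du t <> 0) by (now apply Rmult_integral_contrapositive_currified).
      split.
      + replace (dN t * / (u t * du t)
          - N t * ((du t * du t + u t * ddu t) * / ((u t * du t) * (u t * du t)))) with
          (dN t * / (u t * du t) + N t * (- (du t * du t + u t * ddu t) / (u t * du t) ^ 2))
          by (field; auto).
        apply (is_derive_Rmult N (fun t => / (u t * du t))); [now apply HN|].
        apply (is_derive_inv (fun t => u t * du t)); [|exact UD].
        apply is_derive_Rmult; [now apply Hu | now apply Hdu].
      + destruct (Hh t Ht') as [_ C1]. destruct (Hdu t Ht') as [_ C2].
        pose proof (CN t Ht'). pose proof (Cu t Ht'). pose proof (Cdu t Ht').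
        unfold dN. solve_continuous.
    - intros t Ht. split; [apply Hu; lra | apply Cdu; lra]. }
  assert (L1 : filterlim (fun T => RInt (fun t => N t * (T * sinc (T * u t))) 0 c)
    (Rbar_locally p_infty) (locally 0)).
  { apply (RInt_lim_0_of_interior (Rbar_locally p_infty)
      (fun T t => N t * (T * sinc (T * u t))) (Rabs M)); [lra | | |].
    - intros; apply CNs; lra.
    - intros; apply Bd; lra.
    - intros; apply RL; lra. }
  assert (L2 : filterlim (fun T => RInt (fun t => N t * (T * sinc (T * u t))) c b)
    (Rbar_locally p_infty) (locally 0)).
  { apply (RInt_lim_0_of_interior (Rbar_locally p_infty)
      (fun T t => N t * (T * sinc (T * u t))) (Rabs M)); [lra | | |].
    - intros; apply CNs; lra.
    - intros; apply Bd; lra.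
    - intros; apply RL; lra. }
  (* The phase is positive at [0] and negative at [b], so each side of its zero contributes a full
     [PI / 2]; together they give the factor [PI]. *)
  assert (S0 : filterlim (fun T => Si (T * u 0)) (Rbar_locally p_infty) (locally (PI / 2))).
  { pose proof (Upos 0 ltac:(lra)) as P0.
    apply (filterlim_comp _ _ _ (fun T => T * u 0) Si (Rbar_locally p_infty)
      (Rbar_locally p_infty)); [|apply Si_lim].
    intros P [K HK]. exists (K / u 0). intros T HT. apply HK.
    replace K with (K / u 0 * u 0) by (field; lra). apply Rmult_lt_compat_r; lra. }
  assert (Sb : filterlim (fun T => Si (T * - u b)) (Rbar_locally p_infty) (locally (PI / 2))).
  { pose proof (Uneg b ltac:(lra)) as P0.
    apply (filterlim_comp _ _ _ (fun T => T * - u b) Si (Rbar_locally p_infty)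
      (Rbar_locally p_infty)); [|apply Si_lim].
    intros P [K HK]. exists (K / - u b). intros T HT. apply HK.
    replace K with (K / - u b * - u b) by (field; lra). apply Rmult_lt_compat_r; lra. }
  apply (filterlim_ext (fun T => (RInt (fun t => N t * (T * sinc (T * u t))) 0 c
     + RInt (fun t => N t * (T * sinc (T * u t))) c b)
     + H * (Si (T * u 0) + Si (T * - u b)))).
  (* Exact splitting for each [T]: [h = N - H * du], where the [du] part has primitive
     [Si (T * u)]. *)
  - intros T.
    assert (Ex : forall x y, 0 <= x -> x <= y -> y <= b ->
      ex_RInt (fun t => N t * (T * sinc (T * u t))) x y).
    { intros x y Hx Hxy Hy. apply (ex_RInt_continuous (V := R_CompleteNormedModule)).
      intros z Hz. rewrite Rmin_left, Rmax_right in Hz by lra. apply CNs. lra. }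
    pose proof (is_RInt_Chasles (V := R_NormedModule) _ _ _ _ _ _
      (RInt_correct (V := R_CompleteNormedModule) _ _ _ (Ex 0 c ltac:(lra) ltac:(lra) ltac:(lra)))
      (RInt_correct (V := R_CompleteNormedModule) _ _ _ (Ex c b ltac:(lra) ltac:(lra) ltac:(lra))))
      as A.
    assert (D : is_RInt (fun t => du t * (T * sinc (T * u t))) 0 b (Si (T * u b) - Si (T * u 0))).
    { apply (is_RInt_derive (V := R_CompleteNormedModule) (fun t => Si (T * u t))).
      - intros t Ht. rewrite Rmin_left, Rmax_right in Ht by lra.
        replace (du t * (T * sinc (T * u t))) with (T * du t * sinc (T * u t)) by ring.
        apply (is_derive_comp Si (fun t => T * u t)); [apply is_derive_Si|].
        apply is_derive_scal. now apply Hu.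
      - intros t Ht. rewrite Rmin_left, Rmax_right in Ht by lra.
        apply (continuous_mult (K := R_AbsRing)); [now apply Cdu | now apply Csinc]. }
    pose proof (is_RInt_minus (V := R_NormedModule) _ _ _ _ _ _ A
      (is_RInt_scal (V := R_NormedModule) _ _ _ H _ D)) as B.
    symmetry. apply is_RInt_unique.
    replace (T * - u b) with (- (T * u b)) by ring. rewrite Si_opp.
    match type of B with is_RInt _ _ _ ?v => match goal with |- is_RInt _ _ _ ?w =>
      replace w with v end end.
    + revert B. apply (is_RInt_ext (V := R_NormedModule)). intros t _.
      unfold minus, plus, opp, scal; simpl. unfold mult; simpl. unfold N.
      match goal with |- ?a = ?b => change (@eq R a b) end. ring.
    + unfold minus, plus, opp, scal; simpl. unfold mult; simpl. ring.
  - replace (PI * H) with ((0 + 0) + H * (PI / 2 + PI / 2)) by field.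
    apply (filterlim_Rplus (Rbar_locally p_infty)).
    + now apply (filterlim_Rplus (Rbar_locally p_infty)).
    + apply (filterlim_Rmult (Rbar_locally p_infty)); [apply filterlim_const|].
      now apply (filterlim_Rplus (Rbar_locally p_infty)).
Qed.

(** A primitive of [cos (z v)] in [z] written without division by [v], so that it remains valid
    where the phase vanishes. *)
Lemma is_derive_scaled_sinc (v T : R) :
  is_derive (fun z => z * sinc (z * v)) T (cos (T * v)).
Proof.
  destruct (Req_dec v 0) as [->|Hv].
  - apply (is_derive_ext (fun z => z)).
    + intros t. now rewrite Rmult_0_r, sinc_0, Rmult_1_r.
    + rewrite Rmult_0_r, cos_0. apply (is_derive_id (K := R_AbsRing)).
  - apply (is_derive_ext (fun z => sin (z * v) / v)).
    + intros t. rewrite <- sinc_spec, (Rmult_comm t v), Rmult_assoc. unfold Rdiv.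
      rewrite (Rmult_comm v), Rmult_assoc, Rinv_r, Rmult_1_r; auto.
    + auto_derive; [exact I | field; exact Hv].
Qed.

(** Differentiation under the integral takes the place of Fubini: the exchange of the two integrals
    then follows from the fundamental theorem of calculus in [T]. *)
Lemma is_derive_RInt_amplitude (h : R -> R) (F dF : R -> R -> R) (b T : R) :
  0 <= b ->
  (forall t, 0 <= t <= b -> continuous h t) ->
  (forall T t, is_derive (fun z => F z t) T (dF T t)) ->
  (forall T t, 0 <= t <= b -> continuous (F T) t) ->
  (forall T t, 0 <= t <= b -> continuity_2d_pt dF T t) ->
  is_derive (fun z => RInt (fun t => h t * F z t) 0 b) T (RInt (fun t => h t * dF T t) 0 b).
Proof.
  intros Hb Hh HF CF CdF.
  assert (E : forall z t, Derive (fun u => h t * F u t) z = h t * dF z t).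
  { intros z t. apply is_derive_unique, is_derive_scal, HF. }
  assert (G : RInt (fun t => h t * dF T t) 0 b = RInt (fun t => Derive (fun u => h t * F u t) T) 0 b).
  { apply (RInt_ext (V := R_CompleteNormedModule)). intros t _. now rewrite E. }
  rewrite G.
  apply (is_derive_RInt_param (fun z t => h t * F z t)).
  - apply filter_forall. intros z t _. eexists. apply is_derive_scal, HF.
  - intros t Ht. rewrite Rmin_left, Rmax_right in Ht by auto.
    apply (continuity_2d_pt_ext (fun z t => h t * dF z t)).
    { intros z s. now rewrite E. }
    apply continuity_2d_pt_mult; [|now apply CdF].
    apply (continuity_1d_2d_pt_comp h (fun _ s => s)).
    + apply continuity_pt_filterlim. now apply Hh.
    + apply continuity_2d_pt_id2.
  - apply filter_forall. intros z. apply (ex_RInt_continuous (V := R_CompleteNormedModule)).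
    intros t Ht. rewrite Rmin_left, Rmax_right in Ht by auto.
    apply (continuous_mult (K := R_AbsRing)); [now apply Hh | now apply CF].
Qed.

Lemma continuity_2d_scaled (g u : R -> R) (T t : R) :
  (forall y, continuous g y) -> continuous u t ->
  continuity_2d_pt (fun z s => g (z * u s)) T t.
Proof.
  intros Hg Hu.
  apply (continuity_1d_2d_pt_comp g (fun z s => z * u s)).
  - apply continuity_pt_filterlim, Hg.
  - apply continuity_2d_pt_mult; [apply continuity_2d_pt_id1|].
    apply (continuity_1d_2d_pt_comp u (fun _ s => s)); [|apply continuity_2d_pt_id2].
    now apply continuity_pt_filterlim.
Qed.

Lemma scaled_comp_continuous (g u : R -> R) (T t : R) :
  (forall y, continuous g y) -> continuous u t -> continuous (fun t => g (T * u t)) t.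
Proof.
  intros Hg Hu. apply (continuous_comp (fun t => T * u t) g); [|apply Hg].
  now apply (continuous_scal_r (V := R_NormedModule)).
Qed.

Lemma cos_transform_continuous (h u : R -> R) (b T : R) :
  0 <= b ->
  (forall t, 0 <= t <= b -> continuous h t) -> (forall t, 0 <= t <= b -> continuous u t) ->
  continuous (fun T => RInt (fun t => h t * cos (T * u t)) 0 b) T.
Proof.
  intros Hb Hh Hu.
  apply (ex_derive_continuous (V := R_NormedModule)). eexists.
  apply (is_derive_RInt_amplitude h (fun z t => cos (z * u t)) (fun z t => u t * - sin (z * u t))); auto.
  - intros z t. auto_derive; [exact I | ring].
  - intros z t Ht. apply (scaled_comp_continuous cos); [apply continuous_cos | now apply Hu].
  - intros z t Ht. apply continuity_2d_pt_mult.
    + apply (continuity_1d_2d_pt_comp u (fun _ s => s)); [|apply continuity_2d_pt_id2].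
      now apply continuity_pt_filterlim, Hu.
    + apply (continuity_2d_scaled (fun y => - sin y)); [|now apply Hu].
      intros y. apply (continuous_opp (V := R_NormedModule)), continuous_sin.
Qed.

Lemma sin_transform_continuous (h u : R -> R) (b T : R) :
  0 <= b ->
  (forall t, 0 <= t <= b -> continuous h t) -> (forall t, 0 <= t <= b -> continuous u t) ->
  continuous (fun T => RInt (fun t => h t * sin (T * u t)) 0 b) T.
Proof.
  intros Hb Hh Hu.
  apply (ex_derive_continuous (V := R_NormedModule)). eexists.
  apply (is_derive_RInt_amplitude h (fun z t => sin (z * u t)) (fun z t => u t * cos (z * u t))); auto.
  - intros z t. auto_derive; [exact I | ring].
  - intros z t Ht. apply (scaled_comp_continuous sin); [apply continuous_sin | now apply Hu].
  - intros z t Ht. apply continuity_2d_pt_mult.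
    + apply (continuity_1d_2d_pt_comp u (fun _ s => s)); [|apply continuity_2d_pt_id2].
      now apply continuity_pt_filterlim, Hu.
    + apply (continuity_2d_scaled cos); [apply continuous_cos | now apply Hu].
Qed.

Definition sinc_transform (h u : R -> R) (b T : R) : R := RInt (fun t => h t * (T * sinc (T * u t))) 0 b.

(** [sinc_transform] is a primitive in [T] of the cosine transform and is odd, whence the factor
    [2]. *)
Lemma is_RInt_cos_transform (h u : R -> R) (b T : R) :
  0 <= b ->
  (forall t, 0 <= t <= b -> continuous h t) -> (forall t, 0 <= t <= b -> continuous u t) ->
  is_RInt (fun z => RInt (fun t => h t * cos (z * u t)) 0 b) (- T) T (2 * sinc_transform h u b T).
Proof.
  intros Hb Hh Hu.
  replace (2 * sinc_transform h u b T) with (minus (sinc_transform h u b T) (sinc_transform h u b (- T))).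
  - apply (is_RInt_derive (V := R_CompleteNormedModule) (sinc_transform h u b)).
    + intros z _.
      apply (is_derive_RInt_amplitude h (fun z t => z * sinc (z * u t)) (fun z t => cos (z * u t))); auto.
      * intros y t. apply is_derive_scaled_sinc.
      * intros y t Ht. apply (continuous_scal_r (V := R_NormedModule)).
        apply (scaled_comp_continuous sinc); [apply sinc_continuous | now apply Hu].
      * intros y t Ht. apply (continuity_2d_scaled cos); [apply continuous_cos | now apply Hu].
    + intros z _. now apply cos_transform_continuous.
  - assert (E : sinc_transform h u b (- T) = - sinc_transform h u b T).
    { unfold sinc_transform. rewrite <- (RInt_opp (V := R_CompleteNormedModule)).
      - apply (RInt_ext (V := R_CompleteNormedModule)). intros t _.
        replace (- T * u t) with (- (T * u t)) by ring. rewrite sinc_opp.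
        unfold opp; simpl. ring.
      - apply (ex_RInt_continuous (V := R_CompleteNormedModule)). intros t Ht.
        rewrite Rmin_left, Rmax_right in Ht by auto.
        apply (continuous_mult (K := R_AbsRing)); [now apply Hh|].
        apply (continuous_scal_r (V := R_NormedModule)).
        apply (scaled_comp_continuous sinc); [apply sinc_continuous | now apply Hu]. }
    rewrite E. unfold minus, plus, opp; simpl. ring.
Qed.

(** The reflection [z -> - z] shows that the integral is its own negative. Symmetric truncation thus
    removes the sine part for every [T], not merely in the limit. *)
Lemma is_RInt_sin_transform (h u : R -> R) (b T : R) :
  0 <= b ->
  (forall t, 0 <= t <= b -> continuous h t) -> (forall t, 0 <= t <= b -> continuous u t) ->
  is_RInt (fun z => RInt (fun t => h t * sin (z * u t)) 0 b) (- T) T 0.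
Proof.
  intros Hb Hh Hu.
  set (B := fun z => RInt (fun t => h t * sin (z * u t)) 0 b).
  assert (Ex : ex_RInt B (- T) T).
  { apply (ex_RInt_continuous (V := R_CompleteNormedModule)). intros z _.
    now apply sin_transform_continuous. }
  assert (Odd : forall z, B (- z) = - B z).
  { intros z. unfold B. rewrite <- (RInt_opp (V := R_CompleteNormedModule)).
    - apply (RInt_ext (V := R_CompleteNormedModule)). intros t _.
      replace (- z * u t) with (- (z * u t)) by ring. rewrite sin_neg.
      unfold opp; simpl. ring.
    - apply (ex_RInt_continuous (V := R_CompleteNormedModule)). intros t Ht.
      rewrite Rmin_left, Rmax_right in Ht by auto.
      apply (continuous_mult (K := R_AbsRing)); [now apply Hh|].
      apply (scaled_comp_continuous sin); [apply continuous_sin | now apply Hu]. }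
  pose proof (RInt_correct (V := R_CompleteNormedModule) _ _ _ Ex) as H1.
  pose proof (is_RInt_comp_opp (V := R_NormedModule) B T (- T) (RInt B (- T) T)) as H2.
  rewrite Ropp_involutive in H2. specialize (H2 H1).
  apply (is_RInt_ext _ B) in H2.
  2: { intros z _. rewrite Odd. unfold opp; simpl. ring. }
  apply (is_RInt_swap (V := R_NormedModule)) in H2.
  pose proof (is_RInt_unique _ _ _ _ H2) as E. unfold opp in E; simpl in E.
  replace 0 with (RInt B (- T) T); [exact H1|]. fold B in E. lra.
Qed.

(** * Mellin inversion *)

Definition phase (x th : R) : R := 2 * ln (2 * cos th) - ln x.

Definition amplitude (r x d th : R) : R :=
  Rpower x (- d) * (cos (r * th) * Rpower (2 * cos th) (2 * d + r - 2)).

(** On the line the variable [t] enters only through [exp (i t phase)], so Mellin inversion becomes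
    Fourier inversion. *)
Lemma mellin_kern (r x d t th : R) :
  let s := (RtoC d + Ci * RtoC t)%C in
  (Rcpow x (- s) * kern r (2 * s + RtoC r - 2) th)%C =
  (amplitude r x d th * cos (t * phase x th), amplitude r x d th * sin (t * phase x th)).
Proof.
  intros s. unfold kern.
  transitivity (RtoC (cos (r * th)) * (Rcpow x (- s) * Rcpow (2 * cos th) (2 * s + RtoC r - 2)))%C;
    [ring|].
  unfold Rcpow. rewrite <- Cexp_plus.
  assert (E : (- s * RtoC (ln x) + (2 * s + RtoC r - 2) * RtoC (ln (2 * cos th)))%C =
    (- d * ln x + (2 * d + r - 2) * ln (2 * cos th), t * phase x th)).
  { unfold s, phase. apply injective_projections; simpl; ring. }
  rewrite E. unfold Cexp; simpl. rewrite exp_plus.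
  unfold amplitude, Rpower. apply injective_projections; simpl; ring.
Qed.

Lemma is_derive_phase (x th : R) : 0 < 2 * cos th ->
  is_derive (phase x) th (- 2 * (sin th / cos th)).
Proof. intros H. unfold phase. auto_derive; [exact H | field; lra]. Qed.

Lemma is_derive_phase' (th : R) : 0 < 2 * cos th ->
  is_derive (fun t => - 2 * (sin t / cos t)) th (- 2 / cos th ^ 2).
Proof.
  intros H. auto_derive; [lra|].
  pose proof (sin2_cos2 th) as E. unfold Rsqr in E.
  replace (-2 / cos th ^ 2) with (-2 * (sin th * sin th + cos th * cos th) / cos th ^ 2)
    by (rewrite E; field; lra).
  field. lra.
Qed.

Lemma amplitude_C1 (r x d : R) : exists dh, forall th, 0 < 2 * cos th ->
  is_derive (amplitude r x d) th (dh th) /\ continuous dh th.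
Proof.
  set (e := 2 * d + r - 2).
  exists (fun th => Rpower x (- d) * (- r * sin (r * th) * exp (e * ln (2 * cos th))
    + cos (r * th) * (e * (- sin th / cos th) * exp (e * ln (2 * cos th))))).
  intros th H. split.
  - unfold amplitude, Rpower. fold e. auto_derive; [exact H | field; lra].
  - apply (ex_derive_continuous (V := R_NormedModule)). auto_derive. repeat split; lra.
Qed.

Lemma Rabs_amplitude_le (r x d th : R) :
  Rabs (amplitude r x d th) <= Rpower x (- d) * Rpower (2 * cos th) (2 * d + r - 2).
Proof.
  unfold amplitude.
  assert (0 < Rpower x (- d)) by apply exp_pos.
  assert (0 < Rpower (2 * cos th) (2 * d + r - 2)) by apply exp_pos.
  rewrite !Rabs_mult, (Rabs_right (Rpower x _)), (Rabs_right (Rpower (2 * cos th) _)) by lra.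
  assert (Rabs (cos (r * th)) <= 1) by (apply Rabs_le, COS_bound).
  apply Rmult_le_compat_l; [lra|]. nra.
Qed.

(** A sequence from [PI / 4] up to [PI / 2], used to take limits of integrals along [eventually].
    Its start lies beyond [PI / 6], where the [tail] bounds hold. *)
Definition cutoff (n : nat) : R := PI / 2 - PI / 4 * / (INR n + 1).

Lemma cutoff_bounds (n : nat) : PI / 4 <= cutoff n < PI / 2.
Proof.
  unfold cutoff. pose proof PI_RGT_0. pose proof (pos_INR n).
  assert (0 < / (INR n + 1) <= 1).
  { split; [apply Rinv_0_lt_compat; lra|].
    rewrite <- Rinv_1. apply Rinv_le_contravar; lra. }
  nra.
Qed.

Lemma cutoff_lim : filterlim cutoff eventually (at_left (PI / 2)).
Proof.
  intros P [e He]. destruct (archimed_cor1 (e / PI)) as [N [HN HN0]].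
  { apply Rdiv_lt_0_compat; [apply cond_pos | apply PI_RGT_0]. }
  exists N. intros n Hn. pose proof PI_RGT_0.
  pose proof (cutoff_bounds n). apply He; [|lra].
  apply (Rlt_le_trans _ (PI * / INR N)).
  - change (Rabs (cutoff n - PI / 2) < PI * / INR N).
    apply le_INR in Hn. apply lt_INR in HN0. simpl in HN0.
    assert (0 < / (INR n + 1)) by (apply Rinv_0_lt_compat; lra).
    assert (/ (INR n + 1) <= / INR N) by (apply Rinv_le_contravar; lra).
    rewrite Rabs_left by lra. unfold cutoff. nra.
  - left. apply Rmult_lt_reg_r with (/ PI); [now apply Rinv_0_lt_compat|].
    replace (PI * / INR N * / PI) with (/ INR N) by (field; split; [lra|]; apply not_0_INR; lia).
    exact HN.
Qed.

Definition line_integrand (r x d t : R) : C :=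
  let s := (RtoC d + Ci * RtoC t)%C in (Rcpow x (- s) * kappa r (2 * s + RtoC r - 2))%C.

(** The error is uniform in [t], because [|x^(- s)|] and the real part of the exponent depend only
    on [d]; [(1 - r) / 2 < d] makes the exponent of the tail positive. *)
Lemma line_integrand_approx (r x d b t : R) :
  (1 - r) / 2 < d -> PI / 4 <= b < PI / 2 ->
  Cmod (line_integrand r x d t
    - (RInt (fun th => amplitude r x d th * cos (t * phase x th)) 0 b,
       RInt (fun th => amplitude r x d th * sin (t * phase x th)) 0 b))
  <= Rpower x (- d) * tail (2 * d + r - 1) b.
Proof.
  intros Hd Hb. pose proof PI_RGT_0.
  set (s := (RtoC d + Ci * RtoC t)%C). set (m := (2 * s + RtoC r - 2)%C).
  assert (Hm : Re m = 2 * d + r - 2) by (unfold m, s; simpl; ring).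
  assert (E : (Rcpow x (- s) * CInt (kern r m) 0 b)%C =
    (RInt (fun th => amplitude r x d th * cos (t * phase x th)) 0 b,
     RInt (fun th => amplitude r x d th * sin (t * phase x th)) 0 b)).
  { rewrite <- (is_CInt_unique _ _ _ _ (is_CInt_scal _ _ _ (Rcpow x (- s)) _
      (kern_CInt_correct r m 0 b ltac:(lra) ltac:(lra)))).
    unfold CInt. f_equal; apply (RInt_ext (V := R_CompleteNormedModule)); intros th _;
      unfold m, s; rewrite mellin_kern; reflexivity. }
  unfold line_integrand. fold s. fold m. rewrite <- E.
  replace (Rcpow x (- s) * kappa r m - Rcpow x (- s) * CInt (kern r m) 0 b)%C with
    (Rcpow x (- s) * (kappa r m - CInt (kern r m) 0 b))%C by ring.
  rewrite Cmod_mult, Cmod_Rcpow.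
  replace (Re (- s)%C) with (- d) by (unfold s; simpl; ring).
  apply Rmult_le_compat_l; [left; apply exp_pos|].
  replace (2 * d + r - 1) with (Re m + 1) by (rewrite Hm; ring).
  apply kappa_sub_le; lra.
Qed.

Lemma two_cos_range (b th : R) : 0 <= b < PI / 2 -> 0 <= th <= b -> 0 < 2 * cos th.
Proof. intros Hb Ht. apply two_cos_pos. lra. Qed.

Lemma amplitude_continuous (r x d th : R) : 0 < 2 * cos th -> continuous (amplitude r x d) th.
Proof.
  intros H. destruct (amplitude_C1 r x d) as [dh Hdh].
  apply (ex_derive_continuous (V := R_NormedModule)). eexists. now apply Hdh.
Qed.

Lemma phase_continuous (x th : R) : 0 < 2 * cos th -> continuous (phase x) th.
Proof.
  intros H. apply (ex_derive_continuous (V := R_NormedModule)). eexists. now apply is_derive_phase.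
Qed.

Lemma filterlim_tail_cutoff (K a : R) : 0 < a ->
  filterlim (fun n => K * tail a (cutoff n)) eventually (locally 0).
Proof.
  intros Ha. rewrite <- (Rmult_0_r K).
  apply (filterlim_Rmult eventually); [apply filterlim_const|].
  apply (filterlim_comp _ _ _ cutoff (tail a) eventually (at_left (PI / 2)));
    [apply cutoff_lim | now apply filterlim_tail].
Qed.

Lemma filterlim_uniform (f : nat -> R -> R) (g : R -> R) (B : nat -> R) :
  (forall n t, Rabs (f n t - g t) <= B n) -> filterlim B eventually (locally 0) ->
  filterlim f eventually (locally (T := fct_UniformSpace R R_UniformSpace) g).
Proof.
  intros H HB. apply filterlim_locally. intros eps.
  generalize (proj1 (filterlim_R_iff eventually _ _) HB eps (cond_pos eps)).
  apply filter_imp. intros n Hn t.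
  change (Rabs (f n t - g t) < eps). rewrite Rminus_0_r in Hn.
  eapply Rle_lt_trans; [apply H|]. eapply Rle_lt_trans; [apply Rle_abs | exact Hn].
Qed.

(** The cutoff integrands converge uniformly in [t], which yields at once the integrability of
    [line_integrand] and the interchange of limit and integral at fixed [T]. *)
Lemma line_integrand_is_RInt (r x d T : R) : (1 - r) / 2 < d ->
  exists I, is_RInt (fun t => Re (line_integrand r x d t)) (- T) T I /\
    is_RInt (fun t => Im (line_integrand r x d t)) (- T) T 0 /\
    filterlim (fun n => 2 * sinc_transform (amplitude r x d) (phase x) (cutoff n) T)
      eventually (locally I).
Proof.
  intros Hd.
  assert (Ca : forall n th, 0 <= th <= cutoff n -> continuous (amplitude r x d) th).
  { intros n th Hth. apply amplitude_continuous, (two_cos_range (cutoff n)); [|exact Hth].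
    pose proof (cutoff_bounds n). pose proof PI_RGT_0. lra. }
  assert (Cp : forall n th, 0 <= th <= cutoff n -> continuous (phase x) th).
  { intros n th Hth. apply phase_continuous, (two_cos_range (cutoff n)); [|exact Hth].
    pose proof (cutoff_bounds n). pose proof PI_RGT_0. lra. }
  assert (C0 : forall n, 0 <= cutoff n)
    by (intros n; pose proof (cutoff_bounds n); pose proof PI_RGT_0; lra).
  pose proof (filterlim_tail_cutoff (Rpower x (- d)) (2 * d + r - 1) ltac:(lra)) as HB.
  destruct (filterlim_RInt (V := R_CompleteNormedModule)
    (fun n t => RInt (fun th => amplitude r x d th * cos (t * phase x th)) 0 (cutoff n))
    (- T) T eventually _ (fun t => Re (line_integrand r x d t))
    (fun n => 2 * sinc_transform (amplitude r x d) (phase x) (cutoff n) T)) as [I [L1 L2]].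
  - intros n. apply is_RInt_cos_transform; [apply C0 | apply Ca | apply Cp].
  - apply (filterlim_uniform _ _ _) with (2 := HB). intros n t.
    pose proof (line_integrand_approx r x d (cutoff n) t Hd (cutoff_bounds n)) as B.
    eapply Rle_trans; [|exact B]. rewrite Rabs_minus_sym.
    eapply Rle_trans; [|apply re_le_Cmod]. apply Req_le. f_equal.
  - destruct (filterlim_RInt (V := R_CompleteNormedModule)
      (fun n t => RInt (fun th => amplitude r x d th * sin (t * phase x th)) 0 (cutoff n))
      (- T) T eventually _ (fun t => Im (line_integrand r x d t)) (fun n => 0)) as [I' [M1 M2]].
    + intros n. apply is_RInt_sin_transform; [apply C0 | apply Ca | apply Cp].
    + apply (filterlim_uniform _ _ _) with (2 := HB). intros n t.
      pose proof (line_integrand_approx r x d (cutoff n) t Hd (cutoff_bounds n)) as B.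
      eapply Rle_trans; [|exact B]. rewrite Rabs_minus_sym.
      eapply Rle_trans; [|apply Rabs_Im_le]. apply Req_le. f_equal.
    + exists I. split; [exact L2 | split; [|exact L1]].
      replace 0 with I'; [exact M2|].
      apply (filterlim_locally_unique (V := R_NormedModule) (F := eventually) (fun _ : nat => 0));
        [exact M1 | apply filterlim_const].
Qed.

Lemma phase_antitone (x s t : R) : 0 <= s -> s <= t -> t < PI / 2 -> phase x t <= phase x s.
Proof.
  intros Hs Hst Ht. unfold phase. pose proof (two_cos_pos t ltac:(lra)).
  assert (cos t <= cos s).
  { destruct (Req_dec s t) as [->|]; [lra|]. left. apply cos_decreasing_1; lra. }
  assert (ln (2 * cos t) <= ln (2 * cos s)) by (apply ln_le; lra). lra.
Qed.

(* Beyond [b0] the phase stays away from [0], so the sinc kernel is bounded uniformly in [T]. *)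
Lemma sinc_transform_tail_le (r x d b0 b b' T : R) :
  (1 - r) / 2 < d -> PI / 6 <= b0 -> b0 <= b <= b' -> b' < PI / 2 -> phase x b0 < 0 ->
  Rabs (sinc_transform (amplitude r x d) (phase x) b' T
        - sinc_transform (amplitude r x d) (phase x) b T)
  <= Rpower x (- d) / - phase x b0 * tail (2 * d + r - 1) b.
Proof.
  intros Hd Hb0 Hb Hb' Hneg. pose proof PI_RGT_0.
  set (K := Rpower x (- d) / - phase x b0).
  assert (HK : 0 < K) by (apply Rdiv_lt_0_compat; [apply exp_pos | lra]).
  set (g := fun t => amplitude r x d t * (T * sinc (T * phase x t))).
  assert (Cg : forall t, 0 <= t <= b' -> continuous g t).
  { intros t Ht. pose proof (two_cos_pos t ltac:(lra)) as Hc.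
    apply (continuous_mult (K := R_AbsRing)); [now apply amplitude_continuous|].
    apply (continuous_scal_r (V := R_NormedModule)).
    apply (scaled_comp_continuous sinc); [apply sinc_continuous | now apply phase_continuous]. }
  assert (Ex : forall p q, 0 <= p -> p <= q -> q <= b' -> ex_RInt g p q).
  { intros p q Hp Hpq Hq. apply (ex_RInt_continuous (V := R_CompleteNormedModule)).
    intros z Hz. rewrite Rmin_left, Rmax_right in Hz by lra. apply Cg. lra. }
  unfold sinc_transform. fold g.
  rewrite <- (RInt_Chasles (V := R_CompleteNormedModule) g 0 b b') by (apply Ex; lra).
  assert (E : forall p q : R, plus p q - p = q) by (intros; unfold plus; simpl; ring).
  rewrite E.
  apply Rle_trans with (K * (tail (2 * d + r - 1) b - tail (2 * d + r - 1) b')).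
  - apply (norm_RInt_le (V := R_NormedModule) g
      (fun t => K * (2 * sin t * Rpower (2 * cos t) (2 * d + r - 1 - 1))) b b'); [lra | | |].
    + intros t Ht. change (Rabs (g t) <= K * (2 * sin t * Rpower (2 * cos t) (2 * d + r - 1 - 1))).
      assert (Hp : phase x t <= phase x b0) by (apply phase_antitone; lra).
      assert (S : Rabs (T * sinc (T * phase x t)) <= / - phase x b0).
      { apply Rmult_le_reg_r with (- phase x b0); [lra|]. rewrite Rinv_l by lra.
        apply Rle_trans with (Rabs (T * sinc (T * phase x t)) * Rabs (phase x t)).
        - apply Rmult_le_compat_l; [apply Rabs_pos|]. rewrite Rabs_left; lra.
        - rewrite <- Rabs_mult.
          replace (T * sinc (T * phase x t) * phase x t) with (T * phase x t * sinc (T * phase x t))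
            by ring.
          rewrite sinc_spec. apply Rabs_le, SIN_bound. }
      pose proof (Rabs_amplitude_le r x d t) as A.
      pose proof (power_le_tail_integrand (2 * d + r - 1) t ltac:(lra)) as P.
      replace (2 * d + r - 1 - 1) with (2 * d + r - 2) in * by ring.
      unfold g. rewrite Rabs_mult.
      apply Rle_trans with ((Rpower x (- d) * Rpower (2 * cos t) (2 * d + r - 2)) * / - phase x b0).
      * apply Rmult_le_compat; auto using Rabs_pos.
      * unfold K, Rdiv. rewrite Rmult_assoc, (Rmult_comm (Rpower (2 * cos t) _)), <- Rmult_assoc.
        apply Rmult_le_compat_l; [left; exact HK | exact P].
    + apply (RInt_correct (V := R_CompleteNormedModule)), Ex; lra.
    + apply (is_RInt_scal (V := R_NormedModule)), is_RInt_tail; lra.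
  - apply Rmult_le_compat_l; [lra|]. pose proof (tail_pos (2 * d + r - 1) b' ltac:(lra)). lra.
Qed.

Lemma acos_sqrt_spec (x : R) : 0 < x < 4 ->
  let c := acos (sqrt (x / 4)) in
  0 < c < PI / 2 /\ 2 * cos c = sqrt x /\ 2 * sin c = sqrt (4 - x).
Proof.
  intros Hx c. pose proof PI_RGT_0.
  assert (E : sqrt (x / 4) = sqrt x / 2).
  { rewrite sqrt_div by lra. f_equal. replace 4 with (2 * 2) by ring. apply sqrt_square. lra. }
  assert (S0 : 0 < sqrt x) by (apply sqrt_lt_R0; lra).
  assert (S2 : sqrt x < 2).
  { rewrite <- (sqrt_square 2) by lra. apply sqrt_lt_1; lra. }
  assert (Hcos : cos c = sqrt x / 2) by (unfold c; rewrite cos_acos, E; [reflexivity | rewrite E; lra]).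
  pose proof (acos_bound (sqrt (x / 4))) as Hb. fold c in Hb.
  assert (c <> 0) by (intros E0; rewrite E0, cos_0 in Hcos; lra).
  assert (c < PI / 2).
  { apply Rnot_le_lt. intros Hle. pose proof (cos_le_0 c ltac:(lra) ltac:(lra)). lra. }
  split; [lra|]. split; [lra|].
  assert (Hs : 0 < sin c) by (apply sin_gt_0; lra).
  rewrite <- (sqrt_square (2 * sin c)) by lra. f_equal.
  pose proof (sin2_cos2 c) as H2. unfold Rsqr in H2. rewrite Hcos in H2.
  pose proof (sqrt_sqrt x ltac:(lra)). nra.
Qed.

Lemma line_integral_lim (r x d : R) : 0 < x < 4 -> (1 - r) / 2 < d ->
  let c := acos (sqrt (x / 4)) in
  filterlim (fun T => RInt (fun t => Re (line_integrand r x d t)) (- T) T)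
    (Rbar_locally p_infty)
    (locally (2 * (PI * (amplitude r x d c / (2 * (sin c / cos c)))))).
Proof.
  intros Hx Hd c. pose proof PI_RGT_0.
  destruct (acos_sqrt_spec x Hx) as [Hc [Hcos Hsin]]. fold c in Hc, Hcos, Hsin.
  set (A := amplitude r x d c / (2 * (sin c / cos c))).
  assert (Pc : phase x c = 0).
  { unfold phase. rewrite Hcos. rewrite <- (sqrt_sqrt x) at 2 by lra.
    rewrite ln_mult by (apply sqrt_lt_R0; lra). ring. }
  assert (Dneg : forall t, 0 < t < PI / 2 -> -2 * (sin t / cos t) < 0).
  { intros t Ht. assert (0 < sin t) by (apply sin_gt_0; lra).
    assert (0 < cos t) by (apply cos_gt_0; lra).
    assert (0 < sin t / cos t) by (now apply Rdiv_lt_0_compat). lra. }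
  (* The midpoint puts [b0] strictly between [c] and [PI / 2], where the phase is already negative;
     [PI / 4] keeps it in the range of the [tail] bounds. *)
  set (b0 := Rmax (PI / 4) ((c + PI / 2) / 2)).
  assert (Hb0 : PI / 4 <= b0 < PI / 2 /\ c < b0).
  { unfold b0. pose proof (Rmax_l (PI / 4) ((c + PI / 2) / 2)).
    pose proof (Rmax_r (PI / 4) ((c + PI / 2) / 2)).
    assert (Rmax (PI / 4) ((c + PI / 2) / 2) < PI / 2) by (apply Rmax_lub_lt; lra). lra. }
  assert (Pneg : phase x b0 < 0).
  { rewrite <- Pc.
    apply (strictly_decreasing_of_derive (phase x) (fun t => -2 * (sin t / cos t)) 0 b0); try lra.
    - intros t Ht. apply is_derive_phase, two_cos_pos. lra.
    - intros t Ht. apply Dneg. lra. }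
  set (ST := sinc_transform (amplitude r x d) (phase x)).
  set (K := Rpower x (- d) / - phase x b0). set (a := 2 * d + r - 1).
  assert (Fix : forall b, b0 <= b < PI / 2 ->
    filterlim (ST b) (Rbar_locally p_infty) (locally (PI * A))).
  { intros b Hb. destruct (amplitude_C1 r x d) as [dh Hdh].
    replace A with (amplitude r x d c / - (-2 * (sin c / cos c))) by (unfold A; f_equal; ring).
    apply (fourier_inversion (amplitude r x d) dh (phase x) (fun t => -2 * (sin t / cos t))
      (fun t => -2 / cos t ^ 2) b c); [lra | | | | | exact Pc].
    - intros t Ht. apply Hdh, two_cos_pos. lra.
    - intros t Ht. apply is_derive_phase, two_cos_pos. lra.
    - intros t Ht. pose proof (two_cos_pos t ltac:(lra)). split.
      + now apply is_derive_phase'.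
      + apply (ex_derive_continuous (V := R_NormedModule)). auto_derive.
        apply (pow_nonzero (cos t) 2). lra.
    - intros t Ht. apply Dneg. lra. }
  (* The tail estimate between [b] and [cutoff n] survives [n -> infinity]. Its independence of [T]
     allows [b] to be fixed before [T] is sent to infinity. *)
  assert (Unif : forall b T, b0 <= b < PI / 2 ->
    Rabs (RInt (fun t => Re (line_integrand r x d t)) (- T) T - 2 * ST b T) <= 2 * (K * tail a b)).
  { intros b T Hb.
    destruct (line_integrand_is_RInt r x d T Hd) as [I [HI [_ HL]]].
    rewrite (is_RInt_unique _ _ _ _ HI).
    rewrite <- Cmod_R.
    apply (Cmod_le_limit eventually (fun n => RtoC (2 * ST (cutoff n) T + - (2 * ST b T)))
      (fun _ => 2 * (K * tail a b)) (RtoC (I - 2 * ST b T))).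
    - apply (filterlim_RtoC eventually). apply (filterlim_Rplus eventually); [exact HL|].
      apply filterlim_const.
    - apply filterlim_const.
    - pose proof (cutoff_lim _ (at_left_PI2 b ltac:(lra))) as Ev.
      unfold filtermap in Ev. revert Ev. apply filter_imp. intros n Hn. rewrite Cmod_R.
      replace (2 * ST (cutoff n) T + - (2 * ST b T)) with (2 * (ST (cutoff n) T - ST b T)) by ring.
      rewrite Rabs_mult, (Rabs_right 2) by lra.
      apply Rmult_le_compat_l; [lra|].
      apply (sinc_transform_tail_le r x d b0 b (cutoff n) T); lra. }
  apply (filterlim_R_iff (Rbar_locally p_infty)). intros eps He.
  assert (Small : at_left (PI / 2) (fun b => b0 < b < PI / 2 /\ 2 * (K * tail a b) < eps / 2)).
  { assert (L : filterlim (fun b => 2 * K * tail a b) (at_left (PI / 2)) (locally (2 * K * 0))).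
    { apply (filterlim_Rmult (at_left (PI / 2))); [apply filterlim_const|].
      apply filterlim_tail. unfold a. lra. }
    rewrite Rmult_0_r in L.
    generalize (filter_and (F := at_left (PI / 2)) _ _ (at_left_PI2 b0 ltac:(lra))
      (proj1 (filterlim_R_iff (at_left (PI / 2)) _ _) L (eps / 2) ltac:(lra))).
    apply filter_imp. intros b [H1 H2]. split; [exact H1|].
    rewrite Rminus_0_r in H2. apply Rabs_lt_between in H2. lra. }
  destruct (filter_ex _ Small) as [b [Hb Ht]].
  generalize (proj1 (filterlim_R_iff (Rbar_locally p_infty) _ _) (Fix b ltac:(lra))
    (eps / 4) ltac:(lra)).
  apply filter_imp. intros T HT.
  specialize (Unif b T ltac:(lra)).
  replace (RInt (fun t => Re (line_integrand r x d t)) (- T) T - 2 * (PI * A)) with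
    ((RInt (fun t => Re (line_integrand r x d t)) (- T) T - 2 * ST b T)
     + 2 * (ST b T - PI * A)) by ring.
  eapply Rle_lt_trans; [apply Rabs_triang|].
  rewrite Rabs_mult, (Rabs_right 2) by lra. lra.
Qed.

(** * The closed form of the inverse Mellin transform and its special values *)

Definition V2 (r x : R) : R :=
  cos (r * acos (sqrt (x / 4))) / (PI * sqrt (Rpower x (1 - r) * (4 - x))).

(** At the zero of the phase [(2 cos c)^(2 d) = x^d] cancels [x^(- d)], so the value does not depend
    on the line of integration. *)
Lemma amplitude_value (r x d : R) : 0 < x < 4 ->
  let c := acos (sqrt (x / 4)) in
  2 * (amplitude r x d c / (2 * (sin c / cos c))) / PI = V2 r x.
Proof.
  intros Hx c. destruct (acos_sqrt_spec x Hx) as [Hc [Hcos Hsin]]. fold c in Hc, Hcos, Hsin.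
  pose proof PI_RGT_0.
  assert (S0 : 0 < sqrt x) by (apply sqrt_lt_R0; lra).
  assert (S4 : 0 < sqrt (4 - x)) by (apply sqrt_lt_R0; lra).
  assert (P : Rpower (sqrt x) (2 * d + r - 2) = Rpower x (d + r / 2 - 1)).
  { rewrite <- Rpower_sqrt by lra. rewrite Rpower_mult. f_equal. field. }
  assert (Q : sqrt (Rpower x (1 - r)) = Rpower x (/ 2) * / Rpower x (r / 2)).
  { rewrite <- Rpower_sqrt by apply exp_pos. rewrite Rpower_mult.
    rewrite <- Rpower_Ropp, <- Rpower_plus. f_equal. field. }
  unfold V2. fold c. unfold amplitude. rewrite Hcos, P.
  rewrite sqrt_mult by (try (left; apply exp_pos); lra). rewrite Q.
  replace (sin c / cos c) with (sqrt (4 - x) / sqrt x) by (rewrite <- Hcos, <- Hsin; field; lra).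
  replace (d + r / 2 - 1) with (d + (r / 2 + - (1))) by ring.
  rewrite !Rpower_plus, !Rpower_Ropp, Rpower_1 by lra. rewrite Rpower_sqrt by lra.
  assert (0 < Rpower x d) by apply exp_pos. assert (0 < Rpower x (r / 2)) by apply exp_pos.
  rewrite <- (sqrt_sqrt x) at 4 by lra. field. repeat split; lra.
Qed.

Lemma is_V_2 (r x : R) : 0 < x < 4 -> is_V 2 r x (RtoC (V2 r x)).
Proof.
  intros Hx d Hd0. assert (Hd : (1 - r) / 2 < d) by lra. pose proof PI_RGT_0.
  exists (fun T => RtoC (2 / PI) * (Ci * RtoC (RInt (fun t => Re (line_integrand r x d t)) (- T) T)))%C.
  split.
  - intros T. destruct (line_integrand_is_RInt r x d T Hd) as [I [HI [HI0 _]]].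
    rewrite (is_RInt_unique _ _ _ _ HI). unfold is_vertical_int.
    assert (J : is_CInt (fun t => (RtoC (2 / PI) * Ci) * line_integrand r x d t)%C (- T) T
      ((RtoC (2 / PI) * Ci) * (I, 0))%C).
    { apply is_CInt_scal. split; [exact HI | exact HI0]. }
    assert (E : (RtoC (2 / PI) * Ci * (I, 0) = RtoC (2 / PI) * (Ci * RtoC I))%C)
      by (apply injective_projections; simpl; ring).
    rewrite E in J.
    assert (F : forall t : R, (RtoC (2 / PI) * Ci * line_integrand r x d t)%C =
      (Rcpow x (- (RtoC d + Ci * RtoC t)) * psi 2 r (RtoC d + Ci * RtoC t) * Ci)%C).
    { intros t. rewrite psi_2_kappa by (simpl; lra). unfold line_integrand. ring. }
    apply (is_RInt_ext (V := prod_NormedModule R_AbsRing R_NormedModule R_NormedModule)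
      (fun t => (RtoC (2 / PI) * Ci * line_integrand r x d t)%C)).
    + intros t _. apply F.
    + destruct J as [J1 J2].
      destruct (RtoC (2 / PI) * (Ci * RtoC I))%C as [j1 j2].
      now apply is_RInt_fct_extend_pair.
  (* The factor [2 / PI] of [psi], the [Ci] from the parametrization and the normalization
     [1 / (2 PI i)] combine to [1 / PI^2]. *)
  - apply (filterlim_ext_loc (F := (Rbar_locally p_infty)) (fun T =>
      RtoC (RInt (fun t => Re (line_integrand r x d t)) (- T) T * / (PI * PI)))).
    + apply filter_forall. intros T.
      assert (Ci <> 0) by (intros E; apply (f_equal Im) in E; simpl in E; lra).
      assert (RtoC PI <> 0) by (apply RtoC_neq_0; lra).
      assert (PI * PI <> 0) by (apply Rmult_integral_contrapositive_currified; lra).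
      rewrite RtoC_mult, RtoC_inv, RtoC_mult, RtoC_div by (auto; lra). field. auto.
    + pose proof (line_integral_lim r x d Hx Hd) as L. cbv zeta in L.
      apply (filterlim_RtoC (Rbar_locally p_infty)).
      rewrite <- (amplitude_value r x d Hx). cbv zeta.
      match type of L with filterlim _ _ (locally (2 * (PI * ?A))) => set (B := A) in * end.
      replace (2 * B / PI) with (2 * (PI * B) * / (PI * PI)) by (field; lra).
      apply (filterlim_Rmult (Rbar_locally p_infty)); [exact L | apply filterlim_const].
Qed.

(** Uniqueness is tested on one admissible line, at distance [1] from the threshold: there the
    truncated integrals are determined for each [T], hence so is their limit. *)
Lemma V_2 (r x : R) : 0 < x < 4 -> V 2 r x = RtoC (V2 r x).
Proof.
  intros Hx. apply (iota_unique (V := C_CompleteNormedModule)); [|now apply is_V_2].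
  intros v Hv.
  assert (Hd : 1 - (1 + r) / 2 < 2 - (1 + r) / 2) by lra.
  destruct (Hv _ Hd) as [J [HJ LJ]]. destruct (is_V_2 r x Hx _ Hd) as [J' [HJ' LJ']].
  apply (filterlim_C_unique (Rbar_locally p_infty) _ _ _ LJ).
  revert LJ'. apply (filterlim_ext_loc (F := (Rbar_locally p_infty))).
  apply filter_forall. intros T. f_equal. symmetry.
  apply (filterlim_locally_unique
    (V := prod_NormedModule R_AbsRing R_NormedModule R_NormedModule) _ _ _ (HJ T) (HJ' T)).
Qed.

Theorem corollary4p5 :
  (forall r x : R, 0 < x < 4 ->
     is_V 2 r x (V 2 r x) /\
     V 2 r x = RtoC (cos (r * acos (sqrt (x / 4)))
                     / (PI * sqrt (Rpower x (1 - r) * (4 - x))))) /\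
  (forall x : R, 0 < x < 4 ->
     V 2 0 x = RtoC (1 / (PI * sqrt (x * (4 - x)))) /\
     V 2 (- 1 / 2) x =
       RtoC (1 / (2 * PI) * sqrt ((sqrt x + 2) / (sqrt (x ^ 3) * (4 - x)))) /\
     V 2 (1 / 2) x =
       RtoC (1 / (2 * PI) * sqrt ((sqrt x + 2) / (sqrt x * (4 - x)))) /\
     V 2 1 x = RtoC (sqrt x / (2 * PI * sqrt (4 - x)))).
Proof.
  split.
  - intros r x Hx. split; [|now apply V_2].
    rewrite (V_2 r x Hx). now apply is_V_2.
  - intros x Hx. pose proof PI_RGT_0.
    destruct (acos_sqrt_spec x Hx) as [Hc [Hcos _]]. set (c := acos (sqrt (x / 4))) in *.
    assert (S0 : 0 < sqrt x) by (apply sqrt_lt_R0; lra).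
    assert (S4 : 0 < sqrt (4 - x)) by (apply sqrt_lt_R0; lra).
    (* Half-angle formula: [(2 cos (c / 2))^2 = 2 cos c + 2 = sqrt x + 2], and [cos (c / 2)] is
       positive, which fixes the sign of the root. *)
    assert (Half : cos (1 / 2 * c) = sqrt (sqrt x + 2) / 2).
    { assert (Hp : 0 < cos (1 / 2 * c)) by (apply cos_gt_0; lra).
      replace (sqrt x + 2) with (2 * cos (1 / 2 * c) * (2 * cos (1 / 2 * c))).
      - rewrite sqrt_square by lra. field.
      - rewrite <- Hcos. replace c with (2 * (1 / 2 * c)) at 3 by field.
        rewrite cos_2a_cos. ring. }
    rewrite !V_2 by exact Hx. unfold V2. fold c.
    repeat split; f_equal.
    + rewrite Rmult_0_l, cos_0, Rminus_0_r, Rpower_1 by lra. reflexivity.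
    + replace (- 1 / 2 * c) with (- (1 / 2 * c)) by field. rewrite cos_neg, Half.
      replace (Rpower x (1 - - 1 / 2)) with (sqrt (x ^ 3)).
      2: { rewrite <- Rpower_sqrt by (apply pow_lt; lra).
           rewrite <- Rpower_pow by lra. rewrite Rpower_mult. f_equal. simpl. field. }
      assert (0 < sqrt (x ^ 3)) by (apply sqrt_lt_R0, pow_lt; lra).
      assert (0 < sqrt (x ^ 3) * (4 - x)) by (apply Rmult_lt_0_compat; lra).
      assert (0 < sqrt (sqrt (x ^ 3) * (4 - x))) by (now apply sqrt_lt_R0).
      rewrite sqrt_div by lra. field. lra.
    + rewrite Half.
      replace (Rpower x (1 - 1 / 2)) with (sqrt x).
      2: { rewrite <- Rpower_sqrt by lra. f_equal. field. }
      assert (0 < sqrt x * (4 - x)) by (apply Rmult_lt_0_compat; lra).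
      assert (0 < sqrt (sqrt x * (4 - x))) by (now apply sqrt_lt_R0).
      rewrite sqrt_div by lra. field. lra.
    + rewrite Rmult_1_l. replace (cos c) with (sqrt x / 2) by lra.
      rewrite Rminus_diag, Rpower_O, Rmult_1_l by lra. field. lra.
Qed.
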